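(* Let $\gamma_L,\gamma_R,\alpha_L,\alpha_R,b\in\mathbb{R}$ and consider the planar piecewise linear system $$\begin{cases}\dot x=2\gamma_L x-y-b,\\ \dot y=(1+\gamma_L^2)x-\alpha_L,\end{cases}\ \text{if } x\le 0,\qquad \begin{cases}\dot x=2\gamma_R x-y+b,\\ \dot y=(1+\gamma_R^2)x-\alpha_R,\end{cases}\ \text{if } x>0.$$ The system has a center (period annulus) at infinity if and only if it is time-reversible with respect to $y=0$ or $x=0$. The centers have a time-reversibility with respect to $y=0$ if and only if $b=0$ and $\gamma_L=\gamma_R=0$. The centers have a time-reversibility with respect to $x=0$ if and only if $b=0$, $\gamma_L=-\gamma_R\neq 0$, and either $\alpha_L=\alpha_R=0$ or $\alpha_L=-\alpha_R\neq 0$.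
   Context: On the line $\Sigma=\{x=0\}$ the system is understood with the Filippov convention; orbits sufficiently far from the origin cross $\Sigma$, and the sliding set is the bounded segment joining $(0,-b)$ and $(0,b)$. The linear parts have eigenvalues $\gamma_L\pm i$ and $\gamma_R\pm i$, so both dynamics are of focus type and there is a periodic orbit at infinity. The system has a center (period annulus) at infinity if all orbits passing sufficiently far from the origin are (crossing) periodic orbits, i.e. there is $M>0$ such that the orbit through $(0,y_0)$ is a closed orbit for every $y_0>M$. A planar system is time-reversible with respect to the $x$-axis ($y=0$) if it is invariant under the change $(x,y,\tau)\mapsto(x,-y,-\tau)$, and time-reversible with respect to the $y$-axis ($x=0$) if it is invariant under the change $(x,y,\tau)\mapsto(-x,y,-\tau)$; here $\tau$ is the time variable.
   Formalization: The last equivalence is stated for centers reversible with respect to x=0 but not with respect to y=0; as written it fails for b=0, γ_L=γ_R=0, α_L=−α_R (e.g. all parameters 0), which is a center reversible with respect to both axes. *)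

(* Defs.v *)
From HB Require Import structures.
From mathcomp Require Import all_boot all_order all_algebra.
From mathcomp Require Import all_classical all_reals all_analysis.

Set Implicit Arguments.
Unset Strict Implicit.
Unset Printing Implicit Defensive.

Import Order.TTheory GRing.Theory Num.Theory.
Import numFieldNormedType.Exports.

Local Open Scope classical_set_scope.
Local Open Scope ring_scope.

Definition left_field (R : realType) (gL aL b : R) (p : R * R) : R * R :=
  (2 * gL * p.1 - p.2 - b, (1 + gL ^+ 2) * p.1 - aL).

Definition right_field (R : realType) (gR aR b : R) (p : R * R) : R * R :=
  (2 * gR * p.1 - p.2 + b, (1 + gR ^+ 2) * p.1 - aR).

(* Filippov's convention: on the discontinuity line x = 0 the admissible
   velocities are the convex combinations of the two one-sided fields.  This
   set-valued field is what is meant by "the system". *)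
Definition filippov (R : realType) (XL XR : R * R -> R * R) (p : R * R)
    : set (R * R) :=
  if p.1 < 0 then [set XL p]
  else if 0 < p.1 then [set XR p]
  else [set v | exists l : R, [/\ 0 <= l, l <= 1 &
         v = (l * (XL p).1 + (1 - l) * (XR p).1,
              l * (XL p).2 + (1 - l) * (XR p).2)]].

(* Solutions on [0, T] of the differential inclusion z' \in F z: absolutely
   continuous curves satisfying it almost everywhere.  Absolute continuity is
   written as being the indefinite Lebesgue integral of an integrable velocity
   v (the library has no absolute continuity of functions). *)
Definition inclusion_solution (R : realType) (F : R * R -> set (R * R))
    (T : R) (z : R -> R * R) : Prop :=
  exists v : R -> R * R,
    [/\ (@lebesgue_measure R).-integrable `[0, T] (fun t => (v t).1%:E),
        (@lebesgue_measure R).-integrable `[0, T] (fun t => (v t).2%:E),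
        (forall t, 0 <= t <= T ->
           (z t).1 = (z 0).1 + \int[@lebesgue_measure R]_(s in `[0, t]) (v s).1
           /\
           (z t).2 = (z 0).2 + \int[@lebesgue_measure R]_(s in `[0, t]) (v s).2)
      & {ae @lebesgue_measure R,
           forall t, 0 <= t <= T -> F (z t) (v t)}].

(* Both one-sided fields traverse the line x = 0 at p in the same direction. *)
Definition crossing_point (R : realType) (XL XR : R * R -> R * R) (p : R * R)
    : Prop :=
  p.1 = 0 /\ 0 < (XL p).1 * (XR p).1.

(* One period of a closed orbit through p that meets x = 0 only at crossing
   points.  For p on x = 0 such an orbit is never constant, since 0 is not an
   admissible velocity at a crossing point. *)
Definition crossing_closed_orbit (R : realType) (XL XR : R * R -> R * R)
    (p : R * R) (T : R) (z : R -> R * R) : Prop :=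
  [/\ 0 < T,
      inclusion_solution (filippov XL XR) T z,
      z 0 = p,
      z T = p
    & forall t, 0 <= t <= T -> (z t).1 = 0 -> crossing_point XL XR (z t)].

Definition center_at_infinity (R : realType) (XL XR : R * R -> R * R) : Prop :=
  exists2 M : R, 0 < M &
    forall y0 : R, M < y0 ->
      exists (T : R) (z : R -> R * R), crossing_closed_orbit XL XR (0, y0) T z.

(* Under (x, y, tau) |-> (x, -y, -tau) a velocity (u, w) becomes (-u, w), and
   under (x, y, tau) |-> (-x, y, -tau) it becomes (u, -w). *)
Definition reversible_wrt_y0 (R : realType) (F : R * R -> set (R * R)) : Prop :=
  forall x y u w : R, F (x, y) (u, w) <-> F (x, - y) (- u, w).

Definition reversible_wrt_x0 (R : realType) (F : R * R -> set (R * R)) : Prop :=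
  forall x y u w : R, F (x, y) (u, w) <-> F (- x, y) (u, - w).

(* Main.v *)
Require Import Defs.
From mathcomp Require Import all_boot all_order all_algebra.
From mathcomp Require Import all_classical all_reals all_analysis.
From mathcomp Require Import ring lra.

(** Around its equilibrium each linear system is a rotation composed with a
    dilation, so a large arc in [x <= 0] from [(0, y0)] to [(0, - y1)] is
    described exactly by equating moduli and angles: with [c] the abscissa of
    the equilibrium and [e := b - g * c],
      [spiral g c (y1 - e) = g * pi + spiral (- g) c (y0 + e)],
    where [spiral g c V := ln (V ^+ 2 + c ^+ 2) / 2 + g * atan (c / V)] has the
    rational derivative [(V - g * c) / (V ^+ 2 + c ^+ 2)].  Arcs in [0 <= x]
    reduce to these by the central symmetry.  Comparing both half-turns, the
    sign of the displacement of the return map near infinity is that of the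
    first non-zero quantity among [gL + gR], [b - gL * (c - c')], where [- c']
    is the abscissa of the right equilibrium, [gL * (c ^+ 2 - c' ^+ 2)] and,
    when [c' = - c], [- (gL * c)].  If it is positive, large orbits move
    outwards for ever; if it is negative, this applies to the orbit run
    backwards; if all vanish, the system is reversible.  Conversely, closed
    orbits are glued from explicit arcs. *)

Set Implicit Arguments.
Unset Strict Implicit.
Unset Printing Implicit Defensive.

Import Order.TTheory GRing.Theory Num.Theory.
Import numFieldNormedType.Exports.

Local Open Scope classical_set_scope.
Local Open Scope ring_scope.

(** * The spiral function *)

Definition spiral (R : realType) (g c V : R) : R :=
  2^-1 * ln (V ^+ 2 + c ^+ 2) + g * atan (c / V).

Section Spiral.
Variable R : realType.
Implicit Types g c V x y : R.

Lemma sum_sqr_gt0 V c : 0 < V -> 0 < V ^+ 2 + c ^+ 2.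
Proof. by move=> V0; rewrite ltr_wpDr ?sqr_ge0// exprn_gt0. Qed.

Lemma is_derive_spiral g c V : 0 < V ->
  is_derive V 1 (spiral g c) ((V - g * c) / (V ^+ 2 + c ^+ 2)).
Proof.
move=> V0; have W0 := sum_sqr_gt0 c V0.
have V1 : V != 0 by rewrite gt_eqF.
have dlnW : is_derive V 1 (fun x => ln (x ^+ 2 + c ^+ 2))
    ((V ^+ 2 + c ^+ 2)^-1 * (2 * V)).
  apply: (@is_derive1_comp _ (@ln R) (fun x => x ^+ 2 + c ^+ 2)).
    exact: is_derive1_ln.
  apply: is_derive_eq; rewrite /GRing.scale /=; ring.
have datn : is_derive V 1 (fun x => atan (c / x))
    ((1 + (c / V) ^+ 2)^-1 * (c * - V ^- 2)).
  apply: (@is_derive1_comp _ (@atan R) (fun x => c / x)).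
  have dV : is_derive V 1 (fun x : R => x^-1) (- V ^- 2 *: 1) by exact: is_deriveV.
  apply: is_derive_eq; rewrite /GRing.scale /=; ring.
apply: is_derive_eq; rewrite /GRing.scale /=; field.
by rewrite V1 /= (lt0r_neq0 W0).
Qed.

Lemma derive_lt (f df : R -> R) (x y : R) : x < y ->
  (forall z, x <= z <= y -> is_derive z 1 f (df z)) ->
  (forall z, x < z < y -> 0 < df z) -> f x < f y.
Proof.
move=> xy fdf df0.
have [z] : exists2 z, z \in `]x, y[%R & f y - f x = df z * (y - x).
  apply: MVT => // [z|].
    by rewrite in_itv /= => /andP[xz zy]; apply: fdf; rewrite (ltW xz) (ltW zy).
  apply: derivable_within_continuous => z; rewrite in_itv /= => /fdf zf.
  exact: ex_derive.
rewrite in_itv /= => xzy E.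
by rewrite -subr_gt0 E mulr_gt0 ?df0 ?subr_gt0.
Qed.

Lemma atan_le_norm x : `|atan x| <= `|x|.
Proof.
wlog x0 : x / 0 < x => [hw|].
  have [x0|x0|<-] := ltgtP 0 x; first exact: hw.
    by rewrite -(normrN x) -(normrN (atan x)) -atanN hw ?oppr_gt0.
  by rewrite atan0.
have a0 : 0 < atan x by rewrite -[X in X < _]atan0 lt_atan.
rewrite !gtr0_norm //.
rewrite -subr_ge0 -[X in X <= _](_ : 0 - atan 0 = 0); last by rewrite atan0 subr0.
apply: ltW; apply: (@derive_lt (fun z => z - atan z) (fun z => 1 - (1 + z ^+ 2)^-1)) => //.
  move=> z /andP[z0 _]; rewrite subr_gt0 invf_lt1 ?ltrDl ?exprn_gt0 //.
  by rewrite ltr_pwDl ?sqr_ge0.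
Qed.

Lemma spiral_lt g c V V' : `|g * c| <= V -> 0 < V -> V < V' ->
  spiral g c V < spiral g c V'.
Proof.
move=> gcV V0 VV'.
apply: (derive_lt VV') => [z /andP[Vz _]|z /andP[Vz _]].
  by apply: is_derive_spiral; exact: lt_le_trans Vz.
have z0 := lt_trans V0 Vz.
rewrite divr_gt0 ?sum_sqr_gt0 // subr_gt0 (le_lt_trans (ler_norm _)) //.
exact: le_lt_trans Vz.
Qed.

(** Factoring [V ^+ 2] out of the logarithm leaves [ln V] and two corrections, which
    [ln (1 + x) <= x] and [|atan x| <= |x|] bound by multiples of [V^-1]. *)
Lemma spiral_ln g c V : 1 <= V ->
  `|spiral g c V - ln V| <= (c ^+ 2 + `|g * c|) / V.
Proof.
move=> V1; have V0 : 0 < V by exact: lt_le_trans V1.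
have W0 : 0 <= c ^+ 2 / V ^+ 2 by rewrite divr_ge0 ?sqr_ge0.
have E : 2^-1 * ln (V ^+ 2 + c ^+ 2) - ln V = 2^-1 * ln (1 + c ^+ 2 / V ^+ 2).
  have -> : V ^+ 2 + c ^+ 2 = V ^+ 2 * (1 + c ^+ 2 / V ^+ 2).
    by field; rewrite gt_eqF.
  rewrite lnM ?posrE ?exprn_gt0 ?ltr_pwDl //.
  by rewrite lnXn // -mulr_natl; field.
have -> : spiral g c V - ln V =
    2^-1 * ln (1 + c ^+ 2 / V ^+ 2) + g * atan (c / V) by rewrite -E /spiral; ring.
rewrite (le_trans (ler_normD _ _)) // mulrDl lerD //.
  rewrite ger0_norm; last first.
    by rewrite mulr_ge0 // -ln1 ler_ln ?posrE ?ltr_pwDl // lerDl.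
  have : ln (1 + c ^+ 2 / V ^+ 2) <= c ^+ 2 / V ^+ 2.
    by rewrite le_ln1Dx // (lt_le_trans _ W0).
  have : c ^+ 2 / V ^+ 2 <= c ^+ 2 / V.
    rewrite ler_wpM2l ?sqr_ge0 // lef_pV2 ?posrE ?exprn_gt0 // expr2.
    by rewrite ler_peMl // ltW.
  move: W0; lra.
rewrite !normrM -mulrA ler_wpM2l // (le_trans (atan_le_norm _)) //.
by rewrite normrM normfV (gtr0_norm V0).
Qed.

Lemma ln_sub_le (a b : R) : 0 < a -> 0 < b -> ln a - ln b <= (a - b) / b.
Proof.
move=> a0 b0; rewrite -ln_div ?posrE //.
have -> : a / b = 1 + (a - b) / b by field; rewrite gt_eqF.
rewrite le_ln1Dx // mulrBl mulfV ?gt_eqF //.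
by rewrite ltrBDl subrr divr_gt0.
Qed.

Lemma spiral_asymp g c (e : R) : exists2 K, 0 < K & forall y, K < y ->
  1 <= y - e /\ `|spiral g c (y - e) - ln y| <= K / y.
Proof.
pose A := c ^+ 2 + `|g * c|.
have A0 : 0 <= A by rewrite addr_ge0 ?sqr_ge0.
have e0 := normr_ge0 e; have ee := ler_norm e; have Ne := ler_normr (`|e|) e.
(* The part [2 + 2 * |e|] gives [y - e >= y / 2] and [y - e >= 1]. Shifting the logarithm then costs
   [|e| * (2 / y)], and [spiral_ln] at [y - e] costs [A * (2 / y)]. *)
exists (2 + 2 * `|e| + 2 * A) => [|y Ky]; first lra.
have y0 : 0 < y by lra.
have ye : y / 2 <= y - e by lra.
have ye1 : 1 <= y - e by lra.
split => //.
have ye0 : 0 < y - e by lra.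
have iye : (y - e)^-1 <= 2 / y.
  by rewrite -[2 / y]invf_div lef_pV2 ?posrE //; lra.
have hA : `|spiral g c (y - e) - ln (y - e)| <= A * (2 / y).
  by rewrite (le_trans (spiral_ln _ _ ye1)) // ler_wpM2l.
have h1 : ln (y - e) - ln y <= `|e| * (2 / y).
  rewrite (le_trans (ln_sub_le ye0 y0)) //.
  rewrite (_ : y - e - y = - e); last by ring.
  rewrite -[_ / y]mulr1 mulrAC -mulrA; have : 0 <= y^-1 by rewrite invr_ge0 ltW.
  have : - e <= `|e| by rewrite -normrN ler_norm.
  nra.
have h2 : ln y - ln (y - e) <= `|e| * (2 / y).
  rewrite (le_trans (ln_sub_le y0 ye0)) // (_ : y - (y - e) = e); last by ring.
  rewrite (le_trans (ler_wpM2r _ ee)) ?invr_ge0 ?(ltW ye0) //.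
  by rewrite ler_wpM2l.
have -> : (2 + 2 * `|e| + 2 * A) / y = 2 / y + `|e| * (2 / y) + A * (2 / y).
  by ring.
have y2 : 0 < 2 / y by rewrite divr_gt0.
move: hA; rewrite !ler_norml => /andP[? ?]; apply/andP; split; lra.
Qed.

End Spiral.

(** * Asymptotic comparison of spiral functions *)

Section Eventually.
Variable R : realType.
Implicit Types (a y K : R) (f : R -> R).

Lemma near_pinfty_gt K (P : R -> Prop) :
  (forall y, K < y -> P y) -> \forall y \near +oo, P y.
Proof. by move=> KP; exists K; split; [exact: num_real|]. Qed.

Lemma near_pinftyP (P : R -> Prop) : (\forall y \near +oo, P y) ->
  exists K, forall y, K < y -> P y.
Proof. by case=> K [_ KP]; exists K. Qed.

Lemma near_affine_ge1 a a' : 0 < a -> \forall y \near +oo, 1 <= a * y + a'.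
Proof.
move=> a0; apply: (@near_pinfty_gt ((1 - a') / a)) => y.
by rewrite ltr_pdivrMr // mulrC => h; lra.
Qed.

(** One step of Horner's scheme; iterated, it deduces the sign of a polynomial near infinity from
    its leading coefficient. *)
Lemma near_horner_ge1 f a : (\forall y \near +oo, 1 <= f y) ->
  \forall y \near +oo, 1 <= f y * y + a.
Proof.
move=> f1; near=> y.
have h1 : 1 <= f y by near: y.
have h2 : 1 + `|a| <= y.
  by near: y; apply: (@near_pinfty_gt (1 + `|a|)) => y /ltW.
have := ler_norm (- a); rewrite normrN => h3; have := normr_ge0 a.
nra.
Unshelve. all: by end_near. Qed.

Lemma near_quartic_gt0 a4 a3 a2 a1 a0 : 0 < a4 ->
  \forall y \near +oo, 0 < a4 * y ^+ 4 + a3 * y ^+ 3 + a2 * y ^+ 2 + a1 * y + a0.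
Proof.
move=> a40.
have := near_horner_ge1 a0 (near_horner_ge1 a1 (near_horner_ge1 a2
  (near_affine_ge1 a3 a40))).
apply: filterS => y h.
suff -> : a4 * y ^+ 4 + a3 * y ^+ 3 + a2 * y ^+ 2 + a1 * y + a0 =
  (((a4 * y + a3) * y + a2) * y + a1) * y + a0 by exact: lt_le_trans h.
by ring.
Qed.

Lemma near_divr_lt K (e : R) : 0 <= K -> 0 < e -> \forall y \near +oo, K / y < e.
Proof.
move=> K0 e0; apply: (@near_pinfty_gt (K / e)) => y h.
have y0 : 0 < y by rewrite (le_lt_trans _ h) // divr_ge0 // ltW.
by rewrite ltr_pdivrMr // mulrC -ltr_pdivrMr.
Qed.

(** A function that tends to 0 and eventually increases stays below its limit. This turns the sign
    of a rational derivative into that of a difference of spiral functions. *)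
Lemma near_derive_lt0 f (df : R -> R) K :
  (\forall y \near +oo, `|f y| <= K / y) ->
  (\forall y \near +oo, is_derive (y : R) 1 f (df y)) ->
  (\forall y \near +oo, 0 < df y) ->
  \forall y \near +oo, f y < 0.
Proof.
move=> fK /near_pinftyP[A fA] /near_pinftyP[B fB].
have lt_f x y : Num.max A B < x -> x < y -> f x < f y.
  move=> ABx xy; apply: (derive_lt xy) => [z /andP[xz _]|z /andP[xz _]].
    by apply: fA; apply: lt_le_trans xz; apply: le_lt_trans ABx; rewrite le_max lexx.
  apply: fB; apply: lt_trans xz; apply: le_lt_trans ABx.
  by rewrite le_max lexx orbT.
apply: (@near_pinfty_gt (Num.max A B)) => y ABy.
rewrite ltNge; apply/negP => fy0.
have y1 : y < y + 1 by rewrite ltrDl.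
have f1 : 0 < f (y + 1) by rewrite (le_lt_trans fy0) // lt_f.
have [C fC] := near_pinftyP (near_divr_lt (normr_ge0 K) f1).
have [D fD] := near_pinftyP fK.
(* Beyond [y + 1] and both thresholds, [f t > f (y + 1) > K / t] contradicts the decay of [f]. *)
pose t := `|C| + `|D| + `|y| + 2.
have c1 := ler_norm C; have c2 := ler_norm D; have c3 := ler_norm y.
have c4 := normr_ge0 C; have c5 := normr_ge0 D; have c6 := normr_ge0 y.
have t0 : 0 < t by rewrite /t; lra.
have /fC ht : C < t by rewrite /t; lra.
have /fD ht' : D < t by rewrite /t; lra.
have : f (y + 1) < f t by apply: lt_f; [exact: lt_trans y1|rewrite /t; lra].
have := ler_norm (f t).
have : K / t <= `|K| / t by rewrite ler_wpM2r ?ler_norm // invr_ge0 ltW.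
lra.
Qed.

End Eventually.

(** When [gR = - gL], both half-turn relations carry the same parameter of [spiral] at a given
    ordinate; the gap is what fails to cancel there between the left and the right focus. *)
Definition spiral_gap (R : realType) (g c c' e e' y : R) : R :=
  spiral g c (y - e) - spiral g c' (y - e').

Section SpiralGap.
Variable R : realType.
Implicit Types g c e y : R.

Lemma spiral_gapN g c c' e e' y :
  spiral_gap g c' c e' e y = - spiral_gap g c c' e e' y.
Proof. by rewrite /spiral_gap opprB. Qed.

Lemma spiral_gap_le g c c' e e' : exists2 K, 0 < K &
  \forall y \near +oo, `|spiral_gap g c c' e e' y| <= K / y.
Proof.
have [K1 K10 h1] := spiral_asymp g c e.
have [K2 K20 h2] := spiral_asymp g c' e'.
exists (K1 + K2); first exact: addr_gt0.
apply: (@near_pinfty_gt _ (K1 + K2)) => y Ky.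
have /h1[_] : K1 < y by lra.
have /h2[_] : K2 < y by lra.
rewrite mulrDl /spiral_gap !ler_norml => /andP[? ?] /andP[? ?].
by apply/andP; split; lra.
Qed.

Definition gap_num g c c' e e' y : R :=
  (y - e - g * c) * ((y - e') ^+ 2 + c' ^+ 2) -
  (y - e' - g * c') * ((y - e) ^+ 2 + c ^+ 2).

Definition gap_den (c c' e e' y : R) : R :=
  ((y - e) ^+ 2 + c ^+ 2) * ((y - e') ^+ 2 + c' ^+ 2).

Lemma gap_den_gt0 c c' e e' : \forall y \near +oo, 0 < gap_den c c' e e' y.
Proof.
apply: (@near_pinfty_gt _ (`|e| + `|e'|)) => y h.
have ? := ler_norm e; have ? := ler_norm e'.
have ? := normr_ge0 e; have ? := normr_ge0 e'.
by rewrite mulr_gt0 // sum_sqr_gt0 //; lra.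
Qed.

Lemma is_derive_spiral_gap g c c' e e' : \forall y \near +oo,
  is_derive (y : R) 1 (spiral_gap g c c' e e')
    (gap_num g c c' e e' y / gap_den c c' e e' y).
Proof.
apply: (@near_pinfty_gt _ (`|e| + `|e'|)) => y h.
have ? := ler_norm e; have ? := ler_norm e'.
have ? := normr_ge0 e; have ? := normr_ge0 e'.
have ye : 0 < y - e by lra.
have ye' : 0 < y - e' by lra.
have dshift (a b k : R) : 0 < y - a -> is_derive y 1 (fun z => spiral k b (z - a))
    ((y - a - k * b) / ((y - a) ^+ 2 + b ^+ 2)).
  move=> ya; rewrite -[X in is_derive _ _ _ X]mulr1.
  apply: (@is_derive1_comp _ (spiral k b) (fun z => z - a)).
    exact: is_derive_spiral.
  by apply: is_derive_eq; rewrite subr0.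
have -> : gap_num g c c' e e' y / gap_den c c' e e' y =
    (y - e - g * c) / ((y - e) ^+ 2 + c ^+ 2) -
    (y - e' - g * c') / ((y - e') ^+ 2 + c' ^+ 2).
  rewrite /gap_num /gap_den; field.
  by rewrite !gt_eqF ?sum_sqr_gt0.
by apply: is_deriveB; exact: dshift.
Qed.

(** The cubic terms of [gap_num] cancel, and the hypothesis makes its coefficient of [y ^+ 2]
    positive, so the gap increases to 0. *)
Lemma spiral_gap_lt0 g c c' e e' : 0 < e - e' - g * (c - c') ->
  \forall y \near +oo, spiral_gap g c c' e e' y < 0.
Proof.
move=> h; have [K K0 gK] := spiral_gap_le g c c' e e'.
apply: (near_derive_lt0 gK (is_derive_spiral_gap _ _ _ _ _)).
(* The factor [y ^+ 2] pads the quadratic numerator to the shape of [near_quartic_gt0] without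
   changing its sign. *)
have [a1 [a0 E]] : exists a1 a0, forall y, gap_num g c c' e e' y * y ^+ 2 =
    (e - e' - g * (c - c')) * y ^+ 4 + a1 * y ^+ 3 + a0 * y ^+ 2 + 0 * y + 0.
  exists (e' ^+ 2 + c' ^+ 2 + 2 * e' * (e + g * c) -
          (e ^+ 2 + c ^+ 2 + 2 * e * (e' + g * c'))).
  exists ((e' + g * c') * (e ^+ 2 + c ^+ 2) - (e + g * c) * (e' ^+ 2 + c' ^+ 2)).
  by move=> y; rewrite /gap_num; ring.
near=> y.
have D0 : 0 < gap_den c c' e e' y by near: y; exact: gap_den_gt0.
rewrite divr_gt0 //.
have y0 : 0 < y by near: y; exact: (@near_pinfty_gt _ 0).
rewrite -(pmulr_lgt0 _ (exprn_gt0 2 y0)) E.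
by near: y; exact: near_quartic_gt0.
Unshelve. all: by end_near. Qed.

End SpiralGap.

(** * Gaps whose leading term vanishes *)

Section QuadraticGap.
Variable R : realType.
Implicit Types g c y q : R.

(** These shifts are [b - g * c] and [- (b + g * c')] in the case [b = g * (c - c')], where the
    quadratic coefficient vanishes and the linear one takes over. *)
Lemma gap_num_balanced g c c' y :
  gap_num g c c' (- (g * c')) (- (g * c)) y = - (1 + g ^+ 2) *
    ((c ^+ 2 - c' ^+ 2) * y + g * (c - c') * (c ^+ 2 + c' ^+ 2)).
Proof. by rewrite /gap_num; ring. Qed.

(** The derivative of the gap behaves like [- (1 + g ^+ 2) * (c ^+ 2 - c' ^+ 2) / y ^+ 3], hence the
    gap like [(1 + g ^+ 2) * (c ^+ 2 - c' ^+ 2) / 2 / y ^+ 2]. The difference between [q / y ^+ 2]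
    and the gap is shown to increase to 0. *)
Lemma spiral_gap_balanced_gt g c c' q :
  2 * q < (1 + g ^+ 2) * (c ^+ 2 - c' ^+ 2) ->
  \forall y \near +oo,
    q / y ^+ 2 < spiral_gap g c c' (- (g * c')) (- (g * c)) y.
Proof.
move=> hq; pose e := - (g * c'); pose e' := - (g * c).
pose r := (1 + g ^+ 2) * (g * (c - c') * (c ^+ 2 + c' ^+ 2)).
have [K K0 gK] := spiral_gap_le g c c' e e'.
suff : \forall y \near +oo, q / y ^+ 2 - spiral_gap g c c' e e' y < 0.
  by apply: filterS => y; rewrite subr_lt0.
apply: (@near_derive_lt0 R _ (fun y => - (2 * q) / y ^+ 3 -
  gap_num g c c' e e' y / gap_den c c' e e' y) (`|q| + K)).
- near=> y.
  have hK : `|spiral_gap g c c' e e' y| <= K / y by near: y.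
  have y1 : 1 < y by near: y; exact: (@near_pinfty_gt _ 1).
  have y0 : 0 < y by lra.
  rewrite (le_trans (ler_normB _ _)) // mulrDl lerD //.
  rewrite normrM ler_wpM2l // ger0_norm ?invr_ge0 ?exprn_ge0 ?(ltW y0) //.
  by rewrite lef_pV2 ?posrE ?exprn_gt0 // expr2 ler_peMl // (ltW y1).
- near=> y.
  have y0 : 0 < y by near: y; exact: (@near_pinfty_gt _ 0).
  have yn0 : y != 0 by rewrite gt_eqF.
  have dV : is_derive y 1 (fun z : R => q / z ^+ 2) (- (2 * q) / y ^+ 3).
    have yn20 : y ^+ 2 != 0 by rewrite expf_neq0.
    have d2 : is_derive y 1 (fun z : R => z ^+ 2) (2 * y).
      by apply: is_derive_eq; rewrite /GRing.scale /=; ring.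
    have dV := @is_deriveV R (fun z : R => z ^+ 2) y _ 1 yn20 d2.
    by apply: is_derive_eq; rewrite /GRing.scale /=; field.
  have dG : is_derive y 1 (spiral_gap g c c' e e')
      (gap_num g c c' e e' y / gap_den c c' e e' y).
    by near: y; exact: is_derive_spiral_gap.
  exact: is_deriveB.
(* Over the denominator [y ^+ 3 * gap_den], the derivative has a quartic numerator whose leading
   coefficient is positive by [hq]. *)
- have [a3 [a2 [a1 [a0 E]]]] : exists a3 a2 a1 a0, forall y,
      - (2 * q) * gap_den c c' e e' y - gap_num g c c' e e' y * y ^+ 3 =
      ((1 + g ^+ 2) * (c ^+ 2 - c' ^+ 2) - 2 * q) * y ^+ 4 +
      a3 * y ^+ 3 + a2 * y ^+ 2 + a1 * y + a0.
    pose p := e ^+ 2 + c ^+ 2; pose p' := e' ^+ 2 + c' ^+ 2.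
    exists (r + 4 * q * (e + e')).
    exists (- (2 * q) * (p + p' + 4 * e * e')).
    exists (4 * q * (e * p' + e' * p)); exists (- (2 * q) * p * p').
    by move=> y; rewrite gap_num_balanced /gap_den /r /p /p'; ring.
  near=> y.
  have D0 : 0 < gap_den c c' e e' y by near: y; exact: gap_den_gt0.
  have y0 : 0 < y by near: y; exact: (@near_pinfty_gt _ 0).
  have y30 : 0 < y ^+ 3 by rewrite exprn_gt0.
  have -> : - (2 * q) / y ^+ 3 - gap_num g c c' e e' y / gap_den c c' e e' y =
    (- (2 * q) * gap_den c c' e e' y - gap_num g c c' e e' y * y ^+ 3) /
    (y ^+ 3 * gap_den c c' e e' y) by field; rewrite !gt_eqF.
  apply: divr_gt0; last exact: mulr_gt0.
  rewrite E.
  by near: y; apply: near_quartic_gt0; rewrite subr_gt0.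
Unshelve. all: by end_near. Qed.

Lemma spiral_gap_balanced_lt g c c' q :
  (1 + g ^+ 2) * (c ^+ 2 - c' ^+ 2) < 2 * q ->
  \forall y \near +oo,
    spiral_gap g c c' (- (g * c')) (- (g * c)) y < q / y ^+ 2.
Proof.
move=> hq; have : 2 * - q < (1 + g ^+ 2) * (c' ^+ 2 - c ^+ 2).
  by rewrite -opprB; lra.
move=> /spiral_gap_balanced_gt; apply: filterS => y.
by rewrite spiral_gapN mulNr ltrN2.
Qed.

(** When [c' = - c] the linear term of the balanced numerator vanishes too; the constant left over
    has the sign of [- (g * c)]. *)
Lemma spiral_gap_opposite_lt0 g c : g * c < 0 ->
  \forall y \near +oo, spiral_gap g c (- c) (g * c) (- (g * c)) y < 0.
Proof.
move=> gc; have [K K0 gK] := spiral_gap_le g c (- c) (g * c) (- (g * c)).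
apply: (near_derive_lt0 gK (is_derive_spiral_gap _ _ _ _ _)).
near=> y.
have c0 : c != 0 by apply: contraTneq gc => ->; rewrite mulr0 ltxx.
rewrite divr_gt0 //; last by near: y; exact: gap_den_gt0.
have -> : gap_num g c (- c) (g * c) (- (g * c)) y =
    4 * (1 + g ^+ 2) * c ^+ 2 * (- (g * c)) by rewrite /gap_num; ring.
have g1 : 0 < 1 + g ^+ 2 by rewrite ltr_pwDl ?sqr_ge0.
have c20 : 0 < c ^+ 2 by rewrite exprn_even_gt0.
by apply: mulr_gt0; [do 2!apply: mulr_gt0 => //|rewrite oppr_gt0].
Unshelve. all: by end_near. Qed.

End QuadraticGap.

(** * Displacement of the return map *)

(* [y0] and [- y1] are the ordinates where an arc in [x <= 0] starts and ends. *)
Definition half_return (R : realType) (g c b y0 y1 : R) : Prop :=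
  spiral g c (y1 - (b - g * c)) = g * pi + spiral (- g) c (y0 + (b - g * c)).

(** Lexicographic positivity of the four quantities. The case [c' = - c] is one way for
    [gL * (c ^+ 2 - c' ^+ 2)] to vanish; the others, [gL = 0] and [c = c'], lead to reversible
    systems. *)
Definition outward (R : realType) (gL gR c c' b : R) : Prop :=
  0 < gL + gR \/
  gR = - gL /\
    (0 < b - gL * (c - c') \/
     b = gL * (c - c') /\
       (0 < gL * (c ^+ 2 - c' ^+ 2) \/ c' = - c /\ gL * c < 0)).

Section Displacement.
Variable R : realType.
Implicit Types g c b y : R.

(** By [spiral_asymp] both sides of [half_return] are logarithms up to small errors: a large
    half-turn multiplies the ordinate by about [expR (g * pi)]. *)
Lemma half_return_ln g c b : exists2 K, 0 < K &
  forall y0 y1, K < y0 -> K < y1 -> half_return g c b y0 y1 ->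
  `|ln y1 - ln y0 - g * pi| <= K / y0 + K / y1.
Proof.
have [K1 K10 h1] := spiral_asymp g c (b - g * c).
have [K2 K20 h2] := spiral_asymp (- g) c (- (b - g * c)).
exists (K1 + K2) => [|y0 y1 Ky0 Ky1]; first exact: addr_gt0.
rewrite /half_return => E.
have /h1[_] : K1 < y1 by lra.
have /h2[_] : K2 < y0 by lra.
rewrite opprK E => a0 a1.
have i0 : 0 < y0^-1 by rewrite invr_gt0; lra.
have i1 : 0 < y1^-1 by rewrite invr_gt0; lra.
have := mulr_gt0 K10 i0; have := mulr_gt0 K20 i1.
rewrite !mulrDl.
move: a0 a1; rewrite !ler_norml => /andP[? ?] /andP[? ?] ? ?.
by apply/andP; split; lra.
Qed.

Lemma half_return_ln_lim g c b (d : R) : 0 < d -> exists M, 0 < M /\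
  forall y0 y1, M < y0 -> M < y1 -> half_return g c b y0 y1 ->
  `|ln y1 - ln y0 - g * pi| < d.
Proof.
move=> d0; have [K K0 hK] := half_return_ln g c b.
have d20 : 0 < d / 2 by rewrite divr_gt0.
have [M hM] := near_pinftyP (near_divr_lt (ltW K0) d20).
exists (K + `|M|); split => [|y0 y1 h0 h1 hr].
  by rewrite ltr_pwDl.
have ? := normr_ge0 M; have ? := ler_norm M.
rewrite (le_lt_trans (hK _ _ _ _ hr)); try lra.
have : K / y0 < d / 2 by apply: hM; lra.
have : K / y1 < d / 2 by apply: hM; lra.
lra.
Qed.

(** The terms [g * pi] of the two half-turns cancel. The inequality between gaps then becomes one
    between the values of [spiral (- g) c'] attached to [y0] and [y2], and [spiral] is increasing
    there. *)
Lemma balanced_displacement g c c' b : exists M, forall y0 y1 y2,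
  M < y0 -> M < y1 -> M < y2 ->
  half_return g c b y0 y1 -> half_return (- g) c' b y1 y2 ->
  spiral_gap g c c' (b - g * c) (- (b + g * c')) y1 <
    spiral_gap (- g) c c' (- (b - g * c)) (b + g * c') y0 ->
  y0 < y2.
Proof.
exists (`|b + g * c'| + `|g * c'|) => y0 y1 y2 h0 h1 h2.
rewrite /half_return /spiral_gap mulNr opprK => E1 E2.
rewrite !opprK E1 => h; rewrite ltNge; apply/negP => y20.
have : spiral (- g) c' (y2 - (b + g * c')) <= spiral (- g) c' (y0 - (b + g * c')).
  move: y20; rewrite le_eqVlt => /predU1P[->//|y20].
  have ? := ler_norm (b + g * c'); have ? := normr_ge0 (b + g * c').
  have ? := normr_ge0 (g * c').
  by apply/ltW/spiral_lt; rewrite ?mulNr ?normrN; lra.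
move: E2 h; rewrite opprK; lra.
Qed.

Lemma balanced_gap_lt g c c' b : outward g (- g) c c' b -> exists M,
  forall y0 y1, M < y0 -> M < y1 -> half_return g c b y0 y1 ->
  spiral_gap g c c' (b - g * c) (- (b + g * c')) y1 <
    spiral_gap (- g) c c' (- (b - g * c)) (b + g * c') y0.
Proof.
(* This settles the cases where the gap at [y1] is negative and the one at [y0] is positive. *)
have sep : (\forall y \near +oo,
      spiral_gap g c c' (b - g * c) (- (b + g * c')) y < 0) ->
    (\forall y \near +oo,
      spiral_gap (- g) c' c (b + g * c') (- (b - g * c)) y < 0) ->
    exists M, forall y0 y1, M < y0 -> M < y1 -> half_return g c b y0 y1 ->
      spiral_gap g c c' (b - g * c) (- (b + g * c')) y1 <
      spiral_gap (- g) c c' (- (b - g * c)) (b + g * c') y0.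
  move=> /near_pinftyP[M1 h1] /near_pinftyP[M2 h2].
  exists (Num.max M1 M2) => y0 y1; rewrite !gt_max => /andP[_ /h2 k] /andP[/h1 h _] _.
  by rewrite (lt_trans h) // spiral_gapN; lra.
case=> [|[_ []]]; first by rewrite subrr ltxx.
  by move=> beta; apply: sep; apply: spiral_gap_lt0; lra.
case=> bE [q0|[c'E gc0]]; last first.
  have gc : b - g * c = g * c by rewrite bE c'E; ring.
  have gc' : b + g * c' = g * c by rewrite bE c'E; ring.
  apply: sep; rewrite gc gc' c'E.
    exact: spiral_gap_opposite_lt0.
  have := @spiral_gap_opposite_lt0 _ (- g) (- c).
  by rewrite mulrNN opprK; apply.
(* Here both gaps behave like [q / y ^+ 2] with [0 < g * q], and [y1] is close to [la * y0], which
   makes the gap at [y1] the smaller one. The number 1 lies strictly between [s] and [s * la], so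
   [q * s < q < q * s * la] for either sign of [g]. *)
pose la := expR (g * pi); pose s := 2 / (1 + la).
pose q := (1 + g ^+ 2) * (c ^+ 2 - c' ^+ 2) / 2.
have la0 : 0 < la by exact: expR_gt0.
have la1 : 1 + la != 0 by rewrite gt_eqF // addr_gt0.
have g21 : 0 < 1 + g ^+ 2 by rewrite ltr_pwDl ?sqr_ge0.
have gq : 0 < g * q.
  have -> : g * q = (1 + g ^+ 2) * (g * (c ^+ 2 - c' ^+ 2)) / 2.
    by rewrite /q; ring.
  by rewrite divr_gt0 // mulr_gt0.
have gn0 : g != 0 by apply: contraTneq gq => ->; rewrite mul0r ltxx.
have g20 : 0 < g ^+ 2 by rewrite exprn_even_gt0.
have gla : 0 < g * (la - 1).
  have [g0|g0|g0] := ltgtP 0 g.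
  - by rewrite mulr_gt0 // subr_gt0 /la -expR0 ltr_expR mulr_gt0 ?pi_gt0.
  - rewrite nmulr_rgt0 // subr_lt0 /la -expR0 ltr_expR.
    by rewrite pmulr_llt0 ?pi_gt0.
  - by move: gq; rewrite -g0 mul0r ltxx.
have qla : 0 < q * (la - 1).
  by have := mulr_gt0 gq gla; rewrite mulrACA -expr2 pmulr_rgt0.
have e1 : b - g * c = - (g * c') by rewrite bE; ring.
have e2 : b + g * c' = g * c by rewrite bE; ring.
have hq1 : q * s < q.
  rewrite -subr_gt0 (_ : q - q * s = q * (la - 1) / (1 + la)); last first.
    by rewrite /s; field.
  by rewrite divr_gt0 // addr_gt0.
have hq2 : q < q * s * la.
  rewrite -subr_gt0 (_ : q * s * la - q = q * (la - 1) / (1 + la)); last first.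
    by rewrite /s; field.
  by rewrite divr_gt0 // addr_gt0.
have : (1 + g ^+ 2) * (c ^+ 2 - c' ^+ 2) < 2 * (q * s * la).
  by move: hq2; rewrite {1}/q; lra.
move=> /spiral_gap_balanced_lt /near_pinftyP[M1 h1].
have : 2 * (q * s) < (1 + (- g) ^+ 2) * (c ^+ 2 - c' ^+ 2).
  by move: hq1; rewrite sqrrN {2}/q; lra.
move=> /spiral_gap_balanced_gt /near_pinftyP[M2 h2].
(* With this tolerance [2 * (ln y1 - ln y0) - g * pi] has the sign of [g], which orders [y1 ^+ 2]
   and [la * y0 ^+ 2]. *)
have gpi0 : 0 < `|g * pi / 2|.
  by rewrite normr_gt0 mulf_neq0 // mulf_neq0 // gt_eqF ?pi_gt0.
have [M3 [M30 h3]] := half_return_ln_lim g c b gpi0.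
exists (`|M1| + `|M2| + M3) => y0 y1 hy0 hy1 hr.
have ? := ler_norm M1; have ? := ler_norm M2.
have ? := normr_ge0 M1; have ? := normr_ge0 M2.
have y00 : 0 < y0 by lra.
have y10 : 0 < y1 by lra.
have hr3 : `|ln y1 - ln y0 - g * pi| < `|g * pi / 2| by apply: h3 => //; lra.
rewrite e1 e2.
have /h1 a1 : M1 < y1 by lra.
have : M2 < y0 by lra.
move=> /h2; rewrite !mulNr !opprK => a2.
rewrite (lt_trans a1) // (le_lt_trans _ a2) //.
rewrite ler_pdivrMr ?exprn_gt0 // [leRHS]mulrAC ler_pdivlMr ?exprn_gt0 //.
have s0 : 0 < s by rewrite divr_gt0 // addr_gt0.
suff : 0 <= g * (y1 ^+ 2 - la * y0 ^+ 2).
  rewrite -(pmulr_rge0 _ gq) (_ : g * q * _ = g ^+ 2 * (q * (y1 ^+ 2 - la * y0 ^+ 2)));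
    last by ring.
  by rewrite pmulr_rge0 // => h; have := mulr_ge0 (ltW s0) h; lra.
have lnE : ln (y1 ^+ 2) - ln (la * y0 ^+ 2) = 2 * (ln y1 - ln y0) - g * pi.
  by rewrite lnM ?posrE ?exprn_gt0 // !lnXn // /la expRK; ring.
have p1 : y1 ^+ 2 \is Num.pos by rewrite posrE exprn_gt0.
have p2 : la * y0 ^+ 2 \is Num.pos by rewrite posrE mulr_gt0 ?exprn_gt0.
have [g0|g0|g0] := ltgtP 0 g.
- rewrite pmulr_rge0 // subr_ge0 -ler_ln // -subr_ge0 lnE.
  move: hr3; have gp : 0 < g * pi by rewrite mulr_gt0 ?pi_gt0.
  by rewrite (@gtr0_norm _ (g * pi / 2)) ?divr_gt0 // ltr_norml => /andP[]; lra.
- rewrite nmulr_rge0 // subr_le0 -ler_ln // -subr_le0 lnE.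
  move: hr3; have gp : g * pi < 0 by rewrite pmulr_llt0 ?pi_gt0.
  rewrite (@ltr0_norm _ (g * pi / 2)); last by rewrite pmulr_llt0.
  by rewrite ltr_norml => /andP[]; lra.
- by rewrite -g0 mul0r.
Qed.

Lemma outward_displacement gL gR c c' b : outward gL gR c c' b ->
  exists M, forall y0 y1 y2, M < y0 -> M < y1 -> M < y2 ->
  half_return gL c b y0 y1 -> half_return gR c' b y1 y2 -> y0 < y2.
Proof.
case=> [gg|[gE out]]; last first.
  subst gR; have [M1 h1] := balanced_displacement gL c c' b.
  have [M2 h2] := balanced_gap_lt (or_intror (conj erefl out)).
  exists (Num.max M1 M2) => y0 y1 y2.
  rewrite !gt_max => /andP[a1 a2] /andP[b1 b2] /andP[d1 d2] r1 r2.
  exact: (h1 _ _ _ a1 b1 d1 r1 r2 (h2 _ _ a2 b2 r1)).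
(* A full turn adds about [(gL + gR) * pi] to the logarithm of the ordinate; each half-turn may err
   by less than half of that. *)
have d0 : 0 < (gL + gR) * pi / 2 by rewrite divr_gt0 // mulr_gt0 ?pi_gt0.
have [M1 [M10 h1]] := half_return_ln_lim gL c b d0.
have [M2 [M20 h2]] := half_return_ln_lim gR c' b d0.
exists (M1 + M2) => y0 y1 y2 a0 a1 a2 r1 r2.
have {}H1 : `|ln y1 - ln y0 - gL * pi| < (gL + gR) * pi / 2 by apply: h1 => //; lra.
have {}H2 : `|ln y2 - ln y1 - gR * pi| < (gL + gR) * pi / 2 by apply: h2 => //; lra.
rewrite -ltr_ln ?posrE; try lra.
by move: H1 H2; rewrite !ltr_norml => /andP[? ?] /andP[? ?]; lra.
Qed.

End Displacement.

(** * Arcs of a focus *)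

(** With [z := y + (b - g * c) - g * x], the focus becomes [w' = (g + i) w] for
    [w := (x - c) + i z]. [arc_x] and [arc_z] give its solution with [x = 0] and [z = U] at time
    0. *)
Definition arc_x (R : realType) (g c U t : R) : R :=
  c - expR (g * t) * (c * cos t + U * sin t).

Definition arc_z (R : realType) (g c U t : R) : R :=
  expR (g * t) * (U * cos t - c * sin t).

Section Arc.
Variable R : realType.
Implicit Types g c U K t : R.

Lemma arc_norm g c U t : arc_x g c U t = 0 ->
  arc_z g c U t ^+ 2 + c ^+ 2 = expR (g * t) ^+ 2 * (U ^+ 2 + c ^+ 2).
Proof.
rewrite /arc_x /arc_z => /eqP; rewrite subr_eq0 => /eqP E.
rewrite [X in _ + X ^+ 2 = _]E.
transitivity (expR (g * t) ^+ 2 * (U ^+ 2 + c ^+ 2) * (cos t ^+ 2 + sin t ^+ 2)).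
  by ring.
by rewrite cos2Dsin2 mulr1.
Qed.

Lemma atan_div_bound c U : `|c| <= U -> 0 < U ->
  - (pi / 4) <= atan (c / U) <= pi / 4.
Proof.
move=> cU U0; have /andP[c1 c2] : - U <= c <= U by rewrite -ler_norml.
rewrite -atan1 -atanN !le_atan //.
  by rewrite ler_pdivlMr // mulN1r.
by rewrite ler_pdivrMr // mul1r.
Qed.

Lemma cos_le0 t : pi / 2 <= t <= pi + pi / 2 -> cos t <= 0.
Proof.
move=> /andP[t1 t2]; rewrite -(subrK pi t) cosDpi oppr_le0.
by apply: cos_ge0_pihalf; apply/andP; split; have := pi_gt0 R; lra.
Qed.

(** Seen from the equilibrium, the endpoints deviate from the vertical by the two arctangents. The
    remaining angle [th] has positive cosine, and the bounds on [t] then confine it to the principal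
    branch. *)
Lemma arc_angle g c U t : 0 < U -> `|c| <= U -> `|c| <= - arc_z g c U t ->
  0 < t -> t <= pi + pi / 2 -> arc_x g c U t = 0 -> arc_z g c U t < 0 ->
  t = pi - atan (c / U) - atan (c / - arc_z g c U t).
Proof.
move=> U0 cU cV t0 t3 x0 z0.
have V0 : 0 < - arc_z g c U t by rewrite oppr_gt0.
have pi0 := pi_gt0 R.
have /andP[f1 f2] := atan_div_bound cU U0.
set f := atan (c / U) in f1 f2 *.
have cf : 0 < cos f by apply: cos_gt0_pihalf; apply/andP; split; lra.
have sf : sin f = c / U * cos f.
  have := atanK (c / U); rewrite -/f /tan => <-.
  by field; rewrite gt_eqF.
pose th := pi - t - f.
have e0 := expR_gt0 (g * t).
(* The reciprocal of the modulus of the endpoint: [(cos th, sin th)] is [k] times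
   [(- arc_z g c U t, c)]. *)
pose k := cos f / (U * expR (g * t)).
have k0 : 0 < k by rewrite divr_gt0 // mulr_gt0.
have thE : th = - (t + f - pi) by rewrite /th; ring.
have cth : cos th = - arc_z g c U t * k.
  rewrite thE cosN -(opprK (cos _)) -cosDpi subrK cosD sf /k /arc_z.
  by field; rewrite !gt_eqF.
have sth : sin th = c * k.
  rewrite thE sinN -sinDpi subrK sinD sf.
  move/eqP: x0; rewrite /arc_x subr_eq0 => /eqP x0.
  by rewrite {2}x0 /k; field; rewrite !gt_eqF.
have c0 : 0 < cos th by rewrite cth mulr_gt0.
have th1 : th < pi / 2.
  rewrite ltNge; apply/negP => h; move: c0; rewrite ltNge cos_le0 //.
  by apply/andP; split => //; rewrite /th; lra.
have th2 : - (pi / 2) < th.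
  rewrite ltNge; apply/negP => h; move: c0; rewrite -cosN ltNge cos_le0 //.
  by apply/andP; split; rewrite /th; lra.
suff <- : th = atan (c / - arc_z g c U t) by rewrite /th; ring.
have -> : c / - arc_z g c U t = tan th.
  by rewrite /tan cth sth; rewrite -mulf_div divff ?gt_eqF // mulr1.
by rewrite tanK // in_itv /= th1 th2.
Qed.

(** A large arc is back on the line by time [3 * pi / 2], so its modulus shrinks by a bounded factor
    and it ends far away; modulus and angle of the endpoint then combine into the spiral relation.
    In the original ordinate, [g * c <= - arc_z g c U t] reads [b <= - y] and selects the lower
    endpoint. *)
Lemma arc_return g c K : exists M, 0 < M /\ forall U t, M < U -> 0 < t ->
  (forall s, 0 < s < t -> arc_x g c U s < 0) -> arc_x g c U t = 0 ->
  g * c <= - arc_z g c U t ->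
  [/\ pi / 2 <= t, K < - arc_z g c U t &
      spiral g c (- arc_z g c U t) = g * pi + spiral (- g) c U].
Proof.
have pi0 := pi_gt0 R.
pose T : R := pi + pi / 2.
have T0 : 0 < T by rewrite /T; lra.
pose ka := expR (- (`|g| * T)).
have ka0 : 0 < ka by exact: expR_gt0.
pose K' := `|K| + `|g * c| + `|c| + 1.
have K0 := normr_ge0 K; have gc0 := normr_ge0 (g * c); have c0 := normr_ge0 c.
have cc := ler_norm c; have KK := ler_norm K.
have K'0 : 0 < K' by rewrite /K'; lra.
have M0 : 0 < `|c| / expR (g * T) + (K' + `|c|) / ka + `|c| + 1.
  have : 0 <= `|c| / expR (g * T) by rewrite divr_ge0 ?expR_ge0.
  have : 0 <= (K' + `|c|) / ka by rewrite divr_ge0 ?expR_ge0; lra.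
  by lra.
(* The first term makes [arc_x] positive at [T], the second puts the end beyond [K'] since [ka]
   bounds [expR (g * t)] from below, and the rest gives [|c| <= U]. *)
exists (`|c| / expR (g * T) + (K' + `|c|) / ka + `|c| + 1).
split => // U t MU t0 xneg x0 gcV.
have U0 : 0 < U by exact: lt_trans MU.
have h1 : 0 <= `|c| / expR (g * T) by rewrite divr_ge0 ?expR_ge0.
have h2 : 0 <= (K' + `|c|) / ka by rewrite divr_ge0 ?expR_ge0; lra.
have tT : t <= T.
  rewrite leNgt; apply/negP => Tt.
  have /xneg : 0 < T < t by rewrite T0.
  have : `|c| / expR (g * T) < U by lra.
  rewrite ltr_pdivrMr ?expR_gt0 // => h3.
  have : - c <= `|c| by rewrite -normrN ler_norm.
  have cT : cos T = 0 by rewrite /T addrC cosDpi cos_pihalf oppr0.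
  have sT : sin T = - 1 by rewrite /T addrC sinDpi sin_pihalf.
  by rewrite /arc_x cT sT; lra.
have kat : ka <= expR (g * t).
  rewrite ler_expR lerNl -mulrN.
  have gN : - g <= `|g| by rewrite -normrN ler_norm.
  by rewrite mulrN -mulNr (le_trans (ler_wpM2r (ltW t0) gN)) // ler_wpM2l.
have V2 := arc_norm x0.
set V := - arc_z g c U t in gcV *.
have {}V2 : V ^+ 2 + c ^+ 2 = expR (g * t) ^+ 2 * (U ^+ 2 + c ^+ 2).
  by rewrite /V sqrrN.
have kU : K' + `|c| < ka * U.
  by rewrite mulrC -ltr_pdivrMr //; lra.
have KV : K' < V.
  rewrite ltNge; apply/negP => VK.
  have : V ^+ 2 <= K' ^+ 2.
    rewrite -ler_sqrt ?sqr_ge0 // !sqrtr_sqr (gtr0_norm K'0) ler_norml VK andbT.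
    have : - (g * c) <= `|g * c| by rewrite -normrN ler_norm.
    by rewrite /K'; lra.
  have : (K' + `|c|) ^+ 2 < (ka * U) ^+ 2.
    by rewrite ltr_pXn2r // ?nnegrE; [lra|rewrite mulr_ge0 // ltW].
  have : ka ^+ 2 <= expR (g * t) ^+ 2 by rewrite ler_pXn2r // ?nnegrE ?ltW ?expR_gt0.
  have : `|c| ^+ 2 = c ^+ 2 by rewrite real_normK ?num_real.
  have := mulr_ge0 (ltW K'0) c0; have := sqr_ge0 U.
  have := sqr_ge0 c; have := sqr_ge0 (expR (g * t)).
  rewrite exprMn; nra.
have tE : t = pi - atan (c / U) - atan (c / V).
  apply: (arc_angle (g := g)) => //.
  - by lra.
  - by move: KV; rewrite /V /K'; lra.
  - by move: KV; rewrite /V; lra.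
split.
- have /andP[? ?] : - (pi / 4) <= atan (c / U) <= pi / 4.
    by apply: atan_div_bound => //; lra.
  have /andP[? ?] : - (pi / 4) <= atan (c / V) <= pi / 4.
    by apply: atan_div_bound; move: KV; rewrite /K'; lra.
  by rewrite tE; lra.
- by move: KV; rewrite /K'; lra.
have e0 := expR_gt0 (g * t).
rewrite /spiral V2 lnM ?posrE ?exprn_gt0 ?sum_sqr_gt0 // lnXn // expRK.
by rewrite -mulr_natl {1}tE; field.
Qed.

End Arc.

(** * Explicit solution of a linear focus *)

Section Flow.
Variable R : realType.
Implicit Types (g c b t a : R) (f x y : R -> R).

Lemma constant_on_segment f a b :
  {within `[a, b], continuous f} ->
  (forall t, a < t < b -> is_derive (t : R) 1 f 0) ->
  forall t, a <= t <= b -> f t = f a.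
Proof.
move=> fc fd t /andP[]; rewrite le_eqVlt => /predU1P[->//|at_ tb].
have [s _] : exists2 s, s \in `]a, t[%R & f t - f a = 0 * (t - a).
  apply: (@MVT _ f (fun=> 0)) => // [s|].
    rewrite in_itv /= => /andP[s1 s2]; apply: fd.
    by rewrite s1 (lt_le_trans s2).
  apply: continuous_subspaceW fc => s /=; rewrite !in_itv /= => /andP[-> s2].
  exact: le_trans s2 tb.
by rewrite mul0r => /eqP; rewrite subr_eq0 => /eqP.
Qed.

Lemma focus_flow g a b t0 t1 x y :
  {within `[t0, t1], continuous x} -> {within `[t0, t1], continuous y} ->
  (forall t, t0 < t < t1 ->
    is_derive (t : R) 1 x (2 * g * x t - y t - b) /\
    is_derive (t : R) 1 y ((1 + g ^+ 2) * x t - a)) ->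
  x t0 = 0 -> let c := a / (1 + g ^+ 2) in
  forall t, t0 <= t <= t1 ->
    x t = arc_x g c (y t0 + (b - g * c)) (t - t0) /\
    y t + (b - g * c) - g * x t = arc_z g c (y t0 + (b - g * c)) (t - t0).
Proof.
move=> cx cy dxy x0 c t tI.
have g1 : 1 + g ^+ 2 != 0 by rewrite gt_eqF // ltr_pwDl ?sqr_ge0.
have aE : a = (1 + g ^+ 2) * c by rewrite /c; field.
pose z t := y t + (b - g * c) - g * x t.
(* [E1] and [E2] are the real and imaginary parts of [exp (- (g + i) (t - t0)) * ((x - c) + i z)],
   constant along solutions; undoing this rotation and dilation gives the arcs. *)
pose E1 t := expR (- (g * (t - t0))) *
  (cos (t - t0) * (x t - c) + sin (t - t0) * z t).
pose E2 t := expR (- (g * (t - t0))) *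
  (cos (t - t0) * z t - sin (t - t0) * (x t - c)).
have cz : {within `[t0, t1], continuous z}.
  by move=> s; apply: cvgB; [apply: cvgD; [exact: cy|exact: cvg_cst]|
    apply: cvgM; [exact: cvg_cst|exact: cx]].
have cxc : {within `[t0, t1], continuous (fun t => x t - c)}.
  by move=> s; apply: cvgB; [exact: cx|exact: cvg_cst].
have ce : {within `[t0, t1], continuous (fun t => expR (- (g * (t - t0))))}.
  apply: derivable_within_continuous => s _; exact: ex_derive.
have cc : {within `[t0, t1], continuous (fun t => cos (t - t0))}.
  apply: derivable_within_continuous => s _; exact: ex_derive.
have cs : {within `[t0, t1], continuous (fun t => sin (t - t0))}.
  apply: derivable_within_continuous => s _; exact: ex_derive.
have cE1 : {within `[t0, t1], continuous E1}.
  by move=> s; apply: cvgM; [exact: ce|apply: cvgD; apply: cvgM;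
    [exact: cc|exact: cxc|exact: cs|exact: cz]].
have cE2 : {within `[t0, t1], continuous E2}.
  by move=> s; apply: cvgM; [exact: ce|apply: cvgB; apply: cvgM;
    [exact: cc|exact: cz|exact: cs|exact: cxc]].
have dsh s : is_derive (s : R) 1 (fun t => t - t0) 1.
  by apply: is_derive_eq; rewrite subr0.
have de s : is_derive (s : R) 1 (fun t => expR (- (g * (t - t0))))
    (expR (- (g * (s - t0))) * - g).
  apply: (@is_derive1_comp _ expR (fun t => - (g * (t - t0)))).
  by have ? := dsh s; apply: is_derive_eq; rewrite /GRing.scale /= mulr1.
have dc s : is_derive (s : R) 1 (fun t => cos (t - t0)) (- sin (s - t0) * 1).
  by apply: (@is_derive1_comp _ cos (fun t => t - t0)); exact: dsh.
have ds s : is_derive (s : R) 1 (fun t => sin (t - t0)) (cos (s - t0) * 1).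
  by apply: (@is_derive1_comp _ sin (fun t => t - t0)); exact: dsh.
have dE s : t0 < s < t1 -> is_derive (s : R) 1 E1 0 /\ is_derive (s : R) 1 E2 0.
  move=> /dxy[dx dy]; have := de s; have := dc s; have := ds s => ? ? ?.
  have dz : is_derive s 1 z ((1 + g ^+ 2) * x s - a - g * (2 * g * x s - y s - b)).
    by apply: is_derive_eq; rewrite /GRing.scale /=; ring.
  by split; apply: is_derive_eq; rewrite /GRing.scale /= aE /z; ring.
have E1t := constant_on_segment cE1 (fun s sI => (dE s sI).1) tI.
have E2t := constant_on_segment cE2 (fun s sI => (dE s sI).2) tI.
move: E1t E2t; rewrite /E1 /E2 subrr mulr0 oppr0 expR0 cos0 sin0 /z x0.
set ex := expR _; set C := cos _; set S := sin _ => E1t E2t.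
have exE : expR (g * (t - t0)) * ex = 1 by rewrite /ex -expRD subrr expR0.
have CS : C ^+ 2 + S ^+ 2 = 1 by exact: cos2Dsin2.
rewrite /arc_x /arc_z -/C -/S.
set ep := expR _ in exE *.
set X := x t - c in E1t E2t *.
split.
  have -> : x t = c + (ep * ex) * (C ^+ 2 + S ^+ 2) * X by rewrite exE CS /X; ring.
  have -> : (ep * ex) * (C ^+ 2 + S ^+ 2) * X =
    ep * (C * (ex * (C * X + S * (y t + (b - g * c) - g * x t))) -
          S * (ex * (C * (y t + (b - g * c) - g * x t) - S * X))) by ring.
  by rewrite E1t E2t; ring.
have -> : y t + (b - g * c) - g * x t = (ep * ex) * (C ^+ 2 + S ^+ 2) *
  (y t + (b - g * c) - g * x t) by rewrite exE CS; ring.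
set Z := y t + _ - _ in E1t E2t *.
have -> : (ep * ex) * (C ^+ 2 + S ^+ 2) * Z =
    ep * (S * (ex * (C * X + S * Z)) + C * (ex * (C * Z - S * X))) by ring.
by rewrite E1t E2t; ring.
Qed.

End Flow.

(** * Orbits through crossing points *)

(* The traces on [0, T] of the inclusion solutions that meet [x = 0] only at
   crossing points: they solve the two linear systems off that line and go
   through it from right to left where [0 < y], from left to right where
   [y < 0]. *)
Definition regular_orbit (R : realType) (gL gR aL aR b T : R) (x y : R -> R)
    : Prop :=
  [/\ {within `[0, T], continuous x} /\ {within `[0, T], continuous y},
      forall t, 0 < t < T -> x t < 0 ->
        is_derive t 1 x (2 * gL * x t - y t - b) /\
        is_derive t 1 y ((1 + gL ^+ 2) * x t - aL),
      forall t, 0 < t < T -> 0 < x t ->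
        is_derive t 1 x (2 * gR * x t - y t + b) /\
        is_derive t 1 y ((1 + gR ^+ 2) * x t - aR)
    & forall t, 0 <= t <= T -> x t = 0 ->
        `|b| < `|y t| /\
        exists2 d, 0 < d & forall s, 0 <= s <= T -> 0 < `|s - t| < d ->
          x s * ((s - t) * y t) < 0].

Section Arcs.
Variable R : realType.
Implicit Types (gL gR aL aR b T t : R) (f x y : R -> R).

Lemma continuous_segmentP f (a b : R) : {within `[a, b], continuous f} <->
  forall t, a <= t <= b -> forall e, 0 < e ->
  exists2 d, 0 < d & forall s, a <= s <= b -> `|s - t| < d -> `|f s - f t| < e.
Proof.
rewrite subspace_continuousP; split=> [fc t tI e e0|fc t].
  have tI' : `[a, b]%classic t by rewrite /= in_itv.
  have /cvgrPdist_lt /(_ e e0) := fc t tI'.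
  rewrite near_withinE => -[d /= d0 dP].
  exists d => // s sI st; rewrite distrC; apply: dP => //=.
    by rewrite distrC.
rewrite /= in_itv /= => tI; apply/cvgrPdist_lt => e e0.
have [d d0 dP] := fc t tI e e0.
rewrite near_withinE; exists d => // s /= st.
by rewrite in_itv /= => sI; rewrite distrC dP // distrC.
Qed.

(** The zero is the infimum of the points of []a, b]] where [f] is nonnegative. Since [f a] may be
    0, negativity just after [a] keeps this infimum away from [a]. *)
Lemma first_zero f (a d b : R) : {within `[a, b], continuous f} -> 0 < d ->
  a < b -> (forall s, a < s <= b -> s < a + d -> f s < 0) -> 0 <= f b ->
  exists t, [/\ a < t <= b, f t = 0 & forall s, a < s < t -> f s < 0].
Proof.
move=> /continuous_segmentP fc d0 ab fneg fb.
pose S := [set t | a < t <= b /\ 0 <= f t].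
have Sb : S b by split => //; rewrite ab lexx.
have infS : has_inf S.
  by split; [exists b | exists a => t [/andP[/ltW]]].
have ainf : a < inf S.
  apply: (@lt_le_trans _ _ (Num.min b (a + d))); first by rewrite lt_min ab ltrDl.
  apply: lb_le_inf => [|t [/andP[at_ tb] ft]]; first by exists b.
  rewrite ge_min leNgt -implyNb negbK.
  apply/implyP => tb'; rewrite leNgt; apply/negP => tad.
  by move: ft; rewrite leNgt fneg // at_.
have infb : inf S <= b by apply: ge_inf => //; exact: infS.2.
have neg s : a < s < inf S -> f s < 0.
  move=> /andP[as_ si]; rewrite ltNge; apply/negP => fs.
  have /(ge_inf infS.2) : S s by split => //; rewrite as_ (le_trans (ltW si)).
  by rewrite leNgt si.
exists (inf S); split => //; first by rewrite ainf.
have tI : a <= inf S <= b by rewrite (ltW ainf).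
apply/eqP; rewrite eq_le; apply/andP; split; rewrite leNgt; apply/negP => h.
  have [e e0 eP] := fc _ tI _ h.
  pose s := Num.max ((a + inf S) / 2) (inf S - e / 2).
  have sa : a < s by rewrite lt_max midf_lt.
  have si : s < inf S by rewrite gt_max midf_lt //= ltrBlDr ltrDl divr_gt0.
  have se : inf S - e / 2 <= s by rewrite le_max lexx orbT.
  have : `|f s - f (inf S)| < f (inf S).
    apply: eP; first by rewrite (ltW sa) (le_trans (ltW si)).
    by rewrite ltr0_norm ?subr_lt0 //; lra.
  have := neg s; rewrite sa si => /(_ isT) fs.
  by rewrite ltr_norml => /andP[]; lra.
have h' : 0 < - f (inf S) by rewrite oppr_gt0.
have [e e0 eP] := fc _ tI _ h'.
have [s [Ss se]] : exists s, S s /\ s < inf S + e.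
  have [s Ss se] := inf_adherent e0 infS.
  by exists s.
have is_ : inf S <= s by apply: ge_inf => //; exact: infS.2.
have [/andP[as_ sb] fs] := Ss.
have : `|f s - f (inf S)| < - f (inf S).
  apply: eP; first by rewrite (ltW as_).
  by rewrite ger0_norm ?subr_ge0 //; lra.
by rewrite ltr_norml => /andP[]; lra.
Qed.

(** The crossing condition sends the orbit into [x < 0] just after [t0]; up to its first return,
    which exists because [x T = 0], [focus_flow] identifies it with an explicit arc. *)
Lemma arc_left_plane gL gR aL aR b (K : R) : exists M, forall T x y t0,
  regular_orbit gL gR aL aR b T x y -> 0 <= t0 < T -> x t0 = 0 -> M < y t0 ->
  x T = 0 -> exists t1,
  [/\ t0 + 1 <= t1 <= T, x t1 = 0, K < - y t1 &
      half_return gL (aL / (1 + gL ^+ 2)) b (y t0) (- y t1)].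
Proof.
pose c := aL / (1 + gL ^+ 2); pose e := b - gL * c.
have [M [M0 MP]] := arc_return gL c (K + `|e|).
have e1 := ler_norm e; have e2 : - e <= `|e| by rewrite -normrN ler_norm.
exists (M + `|e|) => T x y t0 [[cx cy] dL _ cross] /andP[t00 t0T] x0 y0 xT.
have y0_gt0 : 0 < y t0 by lra.
have t0I : 0 <= t0 <= T by rewrite t00 ltW.
have sub s t : t <= T -> t0 <= s <= t -> 0 <= s <= T.
  by move=> tT /andP[s1 s2]; rewrite (le_trans t00 s1) (le_trans s2 tT).
have subW t : t <= T -> `[t0, t] `<=` `[0, T].
  by move=> tT s /=; rewrite !in_itv /=; exact: sub.
have [_ [d d0 dP]] := cross _ t0I x0.
have [t1 [/andP[t01 t1T] xt1 xneg]] : exists t1,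
    [/\ t0 < t1 <= T, x t1 = 0 & forall s, t0 < s < t1 -> x s < 0].
  apply: (@first_zero x t0 d T); rewrite ?xT //.
    by apply: continuous_subspaceW cx; exact: subW.
  move=> s /andP[s1 s2] sd.
  have : x s * ((s - t0) * y t0) < 0.
    apply: dP; first by apply: (sub _ T) => //; rewrite ltW.
    by rewrite gtr0_norm ?subr_gt0 //; apply/andP; split; lra.
  by rewrite pmulr_llt0 // mulr_gt0 // subr_gt0.
have t1I : 0 <= t1 <= T by apply: (sub _ T) => //; rewrite ltW.
have dx t : t0 < t < t1 -> is_derive t 1 x (2 * gL * x t - y t - b) /\
    is_derive t 1 y ((1 + gL ^+ 2) * x t - aL).
  move=> /[dup] tI /andP[ta tb]; apply: dL; last exact: xneg.
  by rewrite (le_lt_trans t00 ta) (lt_le_trans tb t1T).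
have cx1 : {within `[t0, t1], continuous x}.
  by apply: continuous_subspaceW cx; exact: subW.
have cy1 : {within `[t0, t1], continuous y}.
  by apply: continuous_subspaceW cy; exact: subW.
have flow := focus_flow cx1 cy1 dx x0.
rewrite -/c -/e in flow.
have [xt1E zt1E] : x t1 = arc_x gL c (y t0 + e) (t1 - t0) /\
    y t1 + e - gL * x t1 = arc_z gL c (y t0 + e) (t1 - t0).
  by apply: flow; rewrite lexx ltW.
(* If [y t1] were positive, the crossing condition would give [0 < x] just before [t1]. *)
have yt1 : b <= - y t1.
  have [by1 [d' d'0 d'P]] := cross _ t1I xt1.
  have [y1|y1] := leP (y t1) 0.
    by move: by1; rewrite (ler0_norm y1) => by1; have := ler_norm b; lra.
  pose s := Num.max ((t0 + t1) / 2) (t1 - d' / 2).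
  have s1 : t0 < s by rewrite lt_max midf_lt.
  have s2 : s < t1 by rewrite gt_max midf_lt //= ltrBlDr ltrDl divr_gt0.
  have s3 : t1 - d' / 2 <= s by rewrite le_max lexx orbT.
  have xs : x s < 0 by apply: xneg; rewrite s1.
  have : x s * ((s - t1) * y t1) < 0.
    apply: d'P; first by apply: (sub _ T) => //; rewrite (ltW s1) (ltW (lt_le_trans s2 t1T)).
    by rewrite ltr0_norm ?subr_lt0 //; apply/andP; split; lra.
  by rewrite nmulr_rlt0 // pmulr_lgt0 // subr_gt0 ltNge ltW.
rewrite xt1 mulr0 subr0 in zt1E.
have [] := MP (y t0 + e) (t1 - t0).
- by lra.
- by rewrite subr_gt0.
- move=> s /andP[s0 s1].
  have [] : x (t0 + s) = arc_x gL c (y t0 + e) (t0 + s - t0) /\ 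
      y (t0 + s) + e - gL * x (t0 + s) = arc_z gL c (y t0 + e) (t0 + s - t0).
    by apply: flow; apply/andP; split; lra.
  have -> : t0 + s - t0 = s by ring.
  by move=> <- _; apply: xneg; apply/andP; split; lra.
- by rewrite -xt1E.
- by rewrite -zt1E /e; lra.
rewrite -zt1E => ht hK hr; exists t1; split => //.
(* The arc lasts at least [pi / 2 >= 1]; this uniform bound limits the number of turns within a
   given time. *)
- by have p1 := pihalf_ge1 R; apply/andP; split; lra.
- by lra.
by rewrite /half_return -/c -/e -hr; congr spiral; ring.
Qed.

End Arcs.

(** * Central symmetry and time reversal *)

Section Symmetries.
Variable R : realType.
Implicit Types (gL gR aL aR b T t : R) (f x y : R -> R).

Lemma regular_orbit_rotation gL gR aL aR b T x y :
  regular_orbit gL gR aL aR b T x y ->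
  regular_orbit gR gL (- aR) (- aL) b T (fun t => - x t) (fun t => - y t).
Proof.
case=> -[cx cy] dL dR cross; split.
- by split=> t; apply: cvgN; [exact: cx|exact: cy].
- move=> t tT; rewrite oppr_lt0 => xt; have [? ?] := dR _ tT xt.
  by split; apply: is_derive_eq; ring.
- move=> t tT; rewrite oppr_gt0 => xt; have [? ?] := dL _ tT xt.
  by split; apply: is_derive_eq; ring.
- move=> t tT /eqP; rewrite oppr_eq0 => /eqP xt.
  have [by_ [d d0 dP]] := cross _ tT xt.
  rewrite normrN; split => //; exists d => // s sT sd.
  by rewrite mulrN mulrNN dP.
Qed.

(** Time reversal alone would invert the sense of rotation; the reflection of [x] restores it, so an
    orbit run backwards is again a regular orbit of a system of the same form. *)
Lemma regular_orbit_reversal gL gR aL aR b T x y :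
  regular_orbit gL gR aL aR b T x y ->
  regular_orbit (- gR) (- gL) (- aR) (- aL) (- b) T
    (fun t => - x (T - t)) (fun t => y (T - t)).
Proof.
case=> -[cx cy] dL dR cross.
have TB t : 0 <= t <= T -> 0 <= T - t <= T.
  by move=> /andP[? ?]; apply/andP; split; lra.
have TBo t : 0 < t < T -> 0 < T - t < T.
  by move=> /andP[? ?]; apply/andP; split; lra.
have crev f : {within `[0, T], continuous f} ->
    {within `[0, T], continuous (fun t => f (T - t))}.
  move=> /continuous_segmentP fc; apply/continuous_segmentP => t tT e e0.
  have [d d0 dP] := fc _ (TB _ tT) _ e0.
  exists d => // s sT sd; apply: dP; first exact: TB.
  by rewrite (_ : _ - _ = - (s - t)) ?normrN //; ring.
have drev f (t l : R) : is_derive (T - t) 1 f l ->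
    is_derive t 1 (fun s => f (T - s)) (- l).
  move=> fd; rewrite (_ : - l = l * -1); last by ring.
  apply: (@is_derive1_comp _ f (fun s => T - s)) => //.
  by apply: is_derive_eq; ring.
split.
- split; last exact: crev.
  by move=> t; apply: cvgN; exact: (crev _ cx).
- move=> t tT; rewrite oppr_lt0 => xt; have [/drev dx /drev dy] := dR _ (TBo _ tT) xt.
  by split; apply: is_derive_eq; ring.
- move=> t tT; rewrite oppr_gt0 => xt; have [/drev dx /drev dy] := dL _ (TBo _ tT) xt.
  by split; apply: is_derive_eq; ring.
- move=> t tT /eqP; rewrite oppr_eq0 => /eqP xt.
  have [by_ [d d0 dP]] := cross _ (TB _ tT) xt.
  rewrite normrN; split => //; exists d => // s sT sd.
  have stE : T - s - (T - t) = - (s - t) by ring.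
  by rewrite mulNr -mulrN -mulNr -stE dP ?TB // stE normrN.
Qed.

Lemma arc_right_plane gL gR aL aR b (K : R) : exists M, forall T x y t0,
  regular_orbit gL gR aL aR b T x y -> 0 <= t0 < T -> x t0 = 0 -> M < - y t0 ->
  x T = 0 -> exists t1,
  [/\ t0 + 1 <= t1 <= T, x t1 = 0, K < y t1 &
      half_return gR (- aR / (1 + gR ^+ 2)) b (- y t0) (y t1)].
Proof.
have [M MP] := arc_left_plane gR gL (- aR) (- aL) b K.
exists M => T x y t0 /regular_orbit_rotation reg t0T x0 y0 xT.
have [||t1 []] := MP _ _ _ _ reg t0T _ y0; rewrite ?x0 ?xT ?oppr0 //.
rewrite opprK => t1T /eqP; rewrite oppr_eq0 => /eqP x1 y1 hr.
by exists t1.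
Qed.

(** Each turn strictly raises the ordinate and takes a minimal time, so the orbit outlives [T]
    without closing up. *)
Lemma outward_no_return gL gR aL aR b :
  outward gL gR (aL / (1 + gL ^+ 2)) (- aR / (1 + gR ^+ 2)) b ->
  exists M, forall T x y, regular_orbit gL gR aL aR b T x y -> 0 < T ->
  x 0 = 0 -> M < y 0 -> x T = 0 -> y T = y 0 -> False.
Proof.
move=> /outward_displacement[M0 disp].
have [M1 arcR] := arc_right_plane gL gR aL aR b M0.
(* The bound 0 makes [y t1] negative, so that [t1] differs from [T]; the other bounds serve the
   right half-turn and the comparison. *)
pose K := Num.max 0 (Num.max M0 M1).
have [M2 arcL] := arc_left_plane gL gR aL aR b K.
exists (Num.max 0 (Num.max M0 M2)) => T x y reg T0 x0.
rewrite !gt_max => /and3P[y0 y0M0 y0M2] xT yT.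
(* Induction on a bound [n] for the time left: the next upper crossing [t2] comes more than one unit
   later, higher up, and therefore before [T]. *)
have tn n t : 0 <= t < T -> x t = 0 -> y 0 <= y t -> T < t + n%:R -> False.
  elim: n t => [|n IHn] t /andP[t0 tT] xt yt; first by rewrite addr0 ltNge ltW.
  move=> tn.
  have [||t1 []] := arcL T x y t reg _ xt _ xT; first by rewrite t0.
    exact: lt_le_trans yt.
  rewrite !gt_max => /andP[t1t t1T] x1 /and3P[y1 y1M0 y1M1] hr1.
  have t1T' : t1 < T.
    rewrite lt_neqAle t1T andbT; apply: contraTneq y1 => ->.
    by rewrite yT oppr_gt0 -leNgt ltW.
  have t10 : 0 <= t1 by lra.
  have [|t2 [/andP[t2t t2T] x2 y2M0 hr2]] := arcR T x y t1 reg _ x1 y1M1 xT.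
    by rewrite t10.
  have yy : y t < y t2 by apply: disp hr1 hr2 => //; exact: lt_le_trans yt.
  have t2T' : t2 < T.
    rewrite lt_neqAle t2T andbT; apply: contraTneq yy => ->.
    by rewrite yT -leNgt.
  apply: (IHn t2) => //.
  - by rewrite t2T' andbT; lra.
  - by rewrite (le_trans yt) // ltW.
  - by move: tn; rewrite -natr1; lra.
apply: (tn (Num.bound T) 0) => //; first by rewrite lexx T0.
by rewrite add0r archi_boundP // ltW.
Qed.

End Symmetries.

(** * Regularity of Filippov solutions *)

Section Primitive.
Variable R : realType.
Notation mu := (@lebesgue_measure R).
Implicit Types (v f : R -> R) (T l e : R).

Lemma lebesgue_ae_imply (P Q : R -> Prop) : (forall r, P r -> Q r) ->
  {ae mu, forall r, P r} -> {ae mu, forall r, Q r}.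
Proof. by move=> PQ; apply: negligibleS; exact: subsetC. Qed.

Lemma ae_Rintegral_dist v (s t : R) l e : s < t -> 0 <= e ->
  mu.-integrable `]s, t] (EFin \o v) ->
  {ae mu, forall r, r \in `]s, t] -> `|v r - l| <= e} ->
  `|\int[mu]_(r in `]s, t]) v r - (t - s) * l| <= e * (t - s).
Proof.
move=> st e0 iv vl.
have lst : fine (mu `]s, t]) = t - s.
  by rewrite lebesgue_measure_itv /= lte_fin st.
have icst (k : R) : mu.-integrable `]s, t] (EFin \o cst k).
  apply: (@integrableS _ _ _ mu `[s, t]) => //.
    by apply: subset_itvr; rewrite bnd_simp.
  apply: continuous_compact_integrable; first exact: segment_compact.
  by move=> x; exact: cvg_cst.
have ivl : mu.-integrable `]s, t] (EFin \o (fun r => v r - l)).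
  by rewrite (_ : _ \o _ = (EFin \o v) \- (EFin \o cst l))%E; [exact: integrableB|].
have -> : \int[mu]_(r in `]s, t]) v r - (t - s) * l =
    \int[mu]_(r in `]s, t]) (v r - l).
  by rewrite RintegralB //; [rewrite Rintegral_cst // lst mulrC|exact: icst].
rewrite (le_trans (le_normr_Rintegral _ ivl)) //.
rewrite -lst -Rintegral_cst // /Rintegral fine_le //.
- apply: integrable_fin_num => //.
  exact: (integrable_norm ivl).
- by apply: integrable_fin_num => //; exact: icst.
apply: ae_ge0_le_integral => //.
- by apply: (measurable_int mu); exact: (integrable_norm ivl).
Qed.

(** A quantitative mean value inequality at [t], valid on one side when [t] is 0 or [T]. Small [e]
    gives derivatives off the line; a fixed [e] gives transversality on it. *)
Lemma ae_primitive_dist v f T t l e d : 0 <= e ->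
  mu.-integrable `[0, T] (EFin \o v) ->
  (forall t, 0 <= t <= T -> f t = f 0 + \int[mu]_(r in `[0, t]) v r) ->
  0 <= t <= T ->
  {ae mu, forall r, 0 <= r <= T -> `|r - t| < d -> `|v r - l| <= e} ->
  forall s, 0 <= s <= T -> `|s - t| < d ->
  `|f s - f t - (s - t) * l| <= e * `|s - t|.
Proof.
move=> e0 iv fE tT vl.
have main (a a' : R) : 0 <= a -> a < a' -> a' <= T -> `|a - t| < d -> `|a' - t| < d ->
    `|f a' - f a - (a' - a) * l| <= e * (a' - a).
  move=> a0 aa' aT ad ad'.
  rewrite (fE a'); last by rewrite aT (le_trans a0) // ltW.
  rewrite (fE a); last by rewrite a0 (le_trans (ltW aa')).
  have -> : f 0 + \int[mu]_(r in `[0, a']) v r - (f 0 + \int[mu]_(r in `[0, a]) v r) =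
      \int[mu]_(r in `]a, a']) v r.
    rewrite -(@Rintegral_itvB _ v (BLeft 0) (BRight a') a); first by ring.
    - apply: integrableS iv => //; apply: subset_itvl.
      by rewrite bnd_simp.
    - by rewrite bnd_simp.
    - by rewrite bnd_simp ltW.
  apply: ae_Rintegral_dist => //.
    apply: integrableS iv => //; move=> r /=; rewrite !in_itv /= => /andP[ar ra].
    by rewrite (le_trans a0 (ltW ar)) (le_trans ra aT).
  apply: lebesgue_ae_imply vl => r h; rewrite in_itv /= => /andP[ar ra]; apply: h.
    by rewrite (le_trans a0 (ltW ar)) (le_trans ra aT).
  by move: ad ad'; rewrite !ltr_norml => /andP[? ?] /andP[? ?]; apply/andP; split; lra.
have [t0 tT'] := andP tT.
move=> s /andP[s0 sT] sd.
have d0 : `|t - t| < d by rewrite subrr normr0 (le_lt_trans _ sd).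
have [st|ts|->] := ltgtP s t.
- have -> : f s - f t - (s - t) * l = - (f t - f s - (t - s) * l) by ring.
  rewrite normrN.
  by rewrite (ltr0_norm (x := s - t)) ?subr_lt0 // opprB main.
- by rewrite (gtr0_norm (x := s - t)) ?subr_gt0 // main.
- by rewrite !subrr mul0r subrr normr0 mulr0.
Qed.

Lemma primitive_continuous v f T : 0 <= T ->
  mu.-integrable `[0, T] (EFin \o v) ->
  (forall t, 0 <= t <= T -> f t = f 0 + \int[mu]_(r in `[0, t]) v r) ->
  {within `[0, T], continuous f}.
Proof.
move=> T0 iv fE; apply/continuous_segmentP => t tT e e0.
have /continuous_segmentP /(_ t tT e e0)[d d0 dP] :=
  parameterized_integral_continuous T0 iv.
exists d => // s sT sd; have := dP s sT sd.
by rewrite /parameterized_integral (fE s sT) (fE t tT) opprD addrACA subrr add0r.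
Qed.

Lemma slope_is_derive f (t l : R) :
  (forall e, 0 < e -> exists2 d, 0 < d &
    forall s, `|s - t| < d -> `|f s - f t - (s - t) * l| <= e * `|s - t|) ->
  is_derive t 1 f l.
Proof.
move=> fl.
have cl : h^-1 *: (f (h *: 1 + t) - f t) @[h --> (0:R)^'] --> l.
  apply/cvgrPdist_le => e e0; have [d d0 dP] := fl e e0.
  near=> h.
  have h0 : h != 0 by near: h; exact: nbhs_dnbhs_neq.
  have hd : `|h| < d by near: h; exact: dnbhs0_lt.
  have := dP (h + t); rewrite addrK => /(_ hd).
  rewrite /GRing.scale /= mulr1 => hl.
  have -> : l - h^-1 * (f (h + t) - f t) = - (h^-1 * (f (h + t) - f t - h * l)).
    by field.
  by rewrite normrN normrM normfV ler_pdivrMl ?normr_gt0 // [leRHS]mulrC.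
apply: DeriveDef; first by apply/cvg_ex; exists l.
exact: cvg_lim cl.
Unshelve. all: by end_near. Qed.

End Primitive.

Section Regularity.
Variable R : realType.
Notation mu := (@lebesgue_measure R).

Lemma ae_primitive_derive (v f L : R -> R) (T t d : R) : 0 < t < T -> 0 < d ->
  mu.-integrable `[0, T] (EFin \o v) ->
  (forall t, 0 <= t <= T -> f t = f 0 + \int[mu]_(r in `[0, t]) v r) ->
  {within `[0, T], continuous L} ->
  {ae mu, forall r, 0 <= r <= T -> `|r - t| < d -> v r = L r} ->
  is_derive t 1 f (L t).
Proof.
move=> /andP[t0 tT] d0 iv fE /continuous_segmentP Lc vL.
have tI : 0 <= t <= T by rewrite !ltW.
apply: slope_is_derive => e e0; have [d' d'0 d'P] := Lc t tI e e0.
pose m := Num.min (Num.min t (T - t)) (Num.min d d').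
have m0 : 0 < m by rewrite !lt_min t0 subr_gt0 tT d0 d'0.
exists m => // s sm; have := sm; rewrite !lt_min => /andP[/andP[st sT] /andP[sd sd']].
apply: (ae_primitive_dist (v := v) (T := T) (d := m)) => //; first exact: ltW.
  apply: lebesgue_ae_imply vL => r vLr rT.
  rewrite !lt_min => /andP[_ /andP[rd rd']].
  by rewrite vLr // ltW // d'P.
by move: st sT; rewrite !ltr_norml => /andP[? ?] /andP[? ?]; apply/andP; split; lra.
Qed.

Lemma filippov_fst gL gR aL aR b (p w : R * R) :
  filippov (left_field gL aL b) (right_field gR aR b) p w ->
  exists2 l, 0 <= l <= 1 &
    w.1 = l * (2 * gL * p.1 - p.2 - b) + (1 - l) * (2 * gR * p.1 - p.2 + b).
Proof.
rewrite /filippov; case: ifP => _ => [->|].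
  by exists 1; rewrite ?lexx ?ler01 //= subrr mul1r mul0r addr0.
case: ifP => _ => [->|[l [l0 l1 ->]]].
  by exists 0; rewrite ?lexx ?ler01 //= mul0r add0r subr0 mul1r.
by exists l; rewrite ?l0.
Qed.

(** Off the line the velocity agrees almost everywhere with a field continuous along the solution,
    hence is a true derivative. At a crossing point all admissible velocities nearby have first
    components of one strict sign. *)
Lemma crossing_closed_orbit_regular gL gR aL aR b p T z :
  crossing_closed_orbit (left_field gL aL b) (right_field gR aR b) p T z ->
  @regular_orbit R gL gR aL aR b T (fun t => (z t).1) (fun t => (z t).2).
Proof.
case=> T0 [v [iv1 iv2 zE Fv]] _ _ cross.
have xE t : 0 <= t <= T -> (z t).1 = (z 0).1 + \int[mu]_(s in `[0, t]) (v s).1.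
  by move=> /zE[].
have yE t : 0 <= t <= T -> (z t).2 = (z 0).2 + \int[mu]_(s in `[0, t]) (v s).2.
  by move=> /zE[].
have cx : {within `[0, T], continuous (fun t => (z t).1)}.
  by apply: (primitive_continuous _ iv1) => //; exact: ltW.
have cy : {within `[0, T], continuous (fun t => (z t).2)}.
  by apply: (primitive_continuous _ iv2) => //; exact: ltW.
have /continuous_segmentP cx' := cx; have /continuous_segmentP cy' := cy.
have clin (k l m : R) :
    {within `[0, T], continuous (fun t => k * (z t).1 + l * (z t).2 + m)}.
  by move=> t; apply: cvgD; [apply: cvgD; apply: cvgM;
    [exact: cvg_cst|exact: cx|exact: cvg_cst|exact: cy]|exact: cvg_cst].
split => //.
- move=> t /[dup] tT /andP[t0 tT'] xt.
  have tI : 0 <= t <= T by rewrite !ltW.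
  have xt0 : 0 < - (z t).1 by rewrite oppr_gt0.
  have [d d0 dP] := cx' t tI _ xt0.
  have vXL : {ae mu, forall r, 0 <= r <= T -> `|r - t| < d ->
      v r = left_field gL aL b (z r)}.
    apply: lebesgue_ae_imply Fv => r Fr rT rd; have := Fr rT.
    have xr : (z r).1 < 0 by have := dP r rT rd; rewrite ltr_norml => /andP[]; lra.
    by rewrite /filippov xr.
  split.
    have -> : 2 * gL * (z t).1 - (z t).2 - b = 2 * gL * (z t).1 + -1 * (z t).2 + - b.
      by ring.
    apply: (ae_primitive_derive tT d0 iv1 xE (clin _ _ _)).
    by apply: lebesgue_ae_imply vXL => r h rT rd; rewrite h //=; ring.
  have -> : (1 + gL ^+ 2) * (z t).1 - aL = (1 + gL ^+ 2) * (z t).1 + 0 * (z t).2 + - aL.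
    by ring.
  apply: (ae_primitive_derive tT d0 iv2 yE (clin _ _ _)).
  by apply: lebesgue_ae_imply vXL => r h rT rd; rewrite h //=; ring.
- move=> t /[dup] tT /andP[t0 tT'] xt.
  have tI : 0 <= t <= T by rewrite !ltW.
  have [d d0 dP] := cx' t tI _ xt.
  have vXR : {ae mu, forall r, 0 <= r <= T -> `|r - t| < d ->
      v r = right_field gR aR b (z r)}.
    apply: lebesgue_ae_imply Fv => r Fr rT rd; have := Fr rT.
    have xr : 0 < (z r).1 by have := dP r rT rd; rewrite ltr_norml => /andP[]; lra.
    by rewrite /filippov xr ltNge (ltW xr).
  split.
    have -> : 2 * gR * (z t).1 - (z t).2 + b = 2 * gR * (z t).1 + -1 * (z t).2 + b.
      by ring.
    apply: (ae_primitive_derive tT d0 iv1 xE (clin _ _ _)).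
    by apply: lebesgue_ae_imply vXR => r h rT rd; rewrite h //=; ring.
  have -> : (1 + gR ^+ 2) * (z t).1 - aR = (1 + gR ^+ 2) * (z t).1 + 0 * (z t).2 + - aR.
    by ring.
  apply: (ae_primitive_derive tT d0 iv2 yE (clin _ _ _)).
  by apply: lebesgue_ae_imply vXR => r h rT rd; rewrite h //=; ring.
move=> t tT xt.
have by_ : `|b| < `|(z t).2|.
  have [_] := cross t tT xt; rewrite /left_field /right_field /= xt => h.
  rewrite -(ltr_pXn2r (n := 2)) ?nnegrE // !real_normK ?num_real //.
  by move: h; lra.
split => //.
(* Near [t] the first component of the velocity differs from [- (z t).2] by at most [rho]: [m / 4]
   for the term in [x], [m / 4] for the variation of [y], and [|b|]. The sum is the midpoint of
   [|b|] and [|(z t).2|]. *)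
pose m := `|(z t).2| - `|b|; pose k := `|gL| + `|gR| + 1.
have m0 : 0 < m by rewrite subr_gt0.
have gL0 := normr_ge0 gL; have gR0 := normr_ge0 gR; have b0 := normr_ge0 b.
have k0 : 0 < k by rewrite /k; lra.
have m4 : 0 < m / 4 by rewrite divr_gt0.
have mk : 0 < m / 4 / (2 * k) by rewrite divr_gt0 // mulr_gt0.
have [d1 d10 d1P] := cx' t tT _ mk; have [d2 d20 d2P] := cy' t tT _ m4.
pose rho := (`|(z t).2| + `|b|) / 2.
exists (Num.min d1 d2); first by rewrite lt_min d10 d20.
move=> s sT /andP[st0 st].
have slope : `|(z s).1 - (z t).1 - (s - t) * (- (z t).2)| <= rho * `|s - t|.
  apply: (ae_primitive_dist _ iv1 xE tT _ sT st).
    by rewrite /rho; lra.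
  apply: lebesgue_ae_imply Fv => r Fr rT; rewrite lt_min => /andP[rd1 rd2].
  have [l /andP[l0 l1] ->] := filippov_fst (Fr rT).
  have := d2P r rT rd2; have := d1P r rT rd1.
  rewrite xt subr0 ltr_pdivlMr ?mulr_gt0 // => hx hy.
  have small g : `|g| <= k -> `|2 * g * (z r).1| <= m / 4.
    move=> gk; rewrite normrM normrM (@ger0_norm _ 2) //.
    rewrite (le_trans _ (ltW hx)) // mulrC ler_wpM2l // ler_wpM2l //.
  have hL : `|gL| <= k by rewrite /k; lra.
  have hR : `|gR| <= k by rewrite /k; lra.
  have eL := small _ hL; have eR := small _ hR.
  have rhoE : rho = m / 4 + m / 4 + `|b| by rewrite /rho /m; field.
  set A := 2 * gL * (z r).1 in eL *; set B := 2 * gR * (z r).1 in eR *.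
  have -> : l * (A - (z r).2 - b) + (1 - l) * (B - (z r).2 + b) - - (z t).2 =
    l * (A - ((z r).2 - (z t).2) - b) + (1 - l) * (B - ((z r).2 - (z t).2) + b) by ring.
  have -> : rho = l * rho + (1 - l) * rho by ring.
  have l1' : 0 <= 1 - l by rewrite subr_ge0.
  rewrite (le_trans (ler_normD _ _)) // !normrM (ger0_norm l0) (ger0_norm l1').
  rewrite lerD // ler_wpM2l // rhoE.
    by rewrite (le_trans (ler_normB _ _)) // lerD // (le_trans (ler_normB _ _)) // lerD // ltW.
  by rewrite (le_trans (ler_normD _ _)) // lerD // (le_trans (ler_normB _ _)) // lerD // ltW.
rewrite xt subr0 in slope.
(* The linear term dominates the remainder [X], because [rho < |(z t).2|]. *)
have xsE : (z s).1 = - (s - t) * (z t).2 + ((z s).1 - (s - t) * - (z t).2) by ring.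
set X := (z s).1 - _ in slope xsE; rewrite xsE.
have -> : (- (s - t) * (z t).2 + X) * ((s - t) * (z t).2) =
  - ((s - t) ^+ 2 * (z t).2 ^+ 2) + X * ((s - t) * (z t).2) by ring.
rewrite addrC subr_lt0 (le_lt_trans (ler_norm _)) // !normrM.
have -> : (s - t) ^+ 2 * (z t).2 ^+ 2 = `|s - t| ^+ 2 * `|(z t).2| ^+ 2.
  by rewrite !real_normK ?num_real.
have y0 : 0 < `|(z t).2| by lra.
rewrite (le_lt_trans (ler_wpM2r _ slope)) ?mulr_ge0 // ?(ltW y0) //.
have -> : rho * `|s - t| * (`|s - t| * `|(z t).2|) = `|s - t| ^+ 2 * `|(z t).2| * rho.
  by ring.
rewrite [ltRHS](_ : _ = `|s - t| ^+ 2 * `|(z t).2| * `|(z t).2|); last by ring.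
by rewrite ltr_pM2l ?mulr_gt0 ?exprn_gt0 // /rho; lra.
Qed.

End Regularity.

(** * A center forces the parameters of a reversible system *)

Section Necessity.
Variable R : realType.
Implicit Types gL gR aL aR b c : R.

(** Reversing time with a reflection changes the sign of all four quantities. If they all vanish,
    then [gL = 0] or [c = c'], and [b = gL * (c - c')] gives [b = 0]. *)
Lemma outward_trichotomy gL gR c c' b :
  [\/ outward gL gR c c' b, outward (- gR) (- gL) c' c (- b),
      b = 0 /\ (gL = 0 /\ gR = 0) | b = 0 /\ (gL = - gR /\ c = c')].
Proof.
have [gg|gg|/esym/eqP] := ltgtP 0 (gL + gR).
- by apply: Or41; left.
- by apply: Or42; left; lra.
rewrite addrC addr_eq0 => /eqP ->; rewrite /outward !opprK.
have [h|h|/esym/eqP] := ltgtP 0 (b - gL * (c - c')).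
- by apply: Or41; right; split; [|left].
- by apply: Or42; right; split => //; left; lra.
rewrite subr_eq0 => /eqP bE.
have bE' : - b = gL * (c' - c) by rewrite bE; ring.
have [h|h|h] := ltgtP 0 (gL * (c ^+ 2 - c' ^+ 2)).
- by apply: Or41; right; split => //; right; split => //; left.
- by apply: Or42; right; split => //; right; split => //; left; lra.
have /eqP := esym h; rewrite mulf_eq0 => /orP[/eqP g0|].
  by apply: Or43; rewrite bE g0 mul0r oppr0.
rewrite subr_eq0 eqf_sqr => /orP[/eqP cc|/eqP cc].
  by apply: Or44; rewrite bE cc subrr mulr0.
have c'E : c' = - c by rewrite cc opprK.
have [k|k|/esym/eqP] := ltgtP 0 (gL * c).
- apply: Or42; right; split => //; right; split => //; right; split => //.
  by rewrite c'E mulrN oppr_lt0.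
- by apply: Or41; right; split => //; right; split => //; right.
rewrite mulf_eq0 => /orP[/eqP g0|/eqP c0].
  by apply: Or43; rewrite bE g0 mul0r oppr0.
by apply: Or44; rewrite bE c'E c0 oppr0 subrr mulr0.
Qed.

Lemma center_at_infinity_necessary gL gR aL aR b :
  center_at_infinity (left_field gL aL b) (right_field gR aR b) ->
  b = 0 /\ (gL = 0 /\ gR = 0) \/ b = 0 /\ (gL = - gR /\ aL = - aR).
Proof.
case=> M0 M00 center.
have far M : exists T x y, [/\ regular_orbit gL gR aL aR b T x y, 0 < T,
    x 0 = 0 /\ x T = 0, M < y 0 & y T = y 0].
  have m0 : M0 < Num.max M0 M + 1 by rewrite ltr_pwDr // le_max lexx.
  have [T [z zP]] := center _ m0.
  exists T; exists (fun t => (z t).1); exists (fun t => (z t).2).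
  have reg := crossing_closed_orbit_regular zP.
  case: zP => T0 _ z0 zT _; rewrite z0 zT; split => //=.
  by rewrite ltr_pwDr // le_max lexx orbT.
have [|||] := outward_trichotomy gL gR (aL / (1 + gL ^+ 2)) (- aR / (1 + gR ^+ 2)) b.
- move=> /outward_no_return[M MP]; have [T [x [y [reg T0 [x0 xT] y0 yT]]]] := far M.
  by have := MP _ _ _ reg T0 x0 y0 xT yT.
(* These rewrites exhibit [c'] and [c] as the abscissas attached to the reversed system. *)
- rewrite -(sqrrN gR) -(sqrrN gL) -[aL]opprK => /outward_no_return[M MP].
  have [T [x [y [reg T0 [x0 xT] y0 yT]]]] := far M.
  have := MP _ _ _ (regular_orbit_reversal reg) T0.
  by rewrite subr0 subrr x0 xT yT oppr0 => /(_ erefl y0 erefl erefl).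
- by left.
move=> [b0 [gE cE]]; right; split => //; split => //.
have g1 : 1 + gR ^+ 2 != 0 by rewrite gt_eqF // ltr_pwDl ?sqr_ge0.
by apply: (mulIf (invr_neq0 g1)); rewrite -cE gE sqrrN.
Qed.

End Necessity.

(** * Closed orbits *)

Section Glue.
Variable R : realType.
Notation mu := (@lebesgue_measure R).

Lemma Rintegral_derive (f F : R -> R) (s t : R) : s <= t -> continuous f ->
  (forall r, is_derive (r : R) 1 F (f r)) ->
  mu.-integrable `[s, t] (EFin \o f) /\
  \int[mu]_(r in `[s, t]) f r = F t - F s.
Proof.
move=> st fc dF; split.
  apply: continuous_compact_integrable; first exact: segment_compact.
  exact: continuous_subspaceT.
move: st; rewrite le_eqVlt => /predU1P[<-|st].
  by rewrite set_itv1 Rintegral_set1 subrr.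
have cF : continuous F.
  by move=> r; apply/differentiable_continuous/derivable1_diffP; exact: ex_derive.
rewrite /Rintegral (@continuous_FTC2 _ f F) //.
- exact: continuous_subspaceT.
- split; first by move=> r _; exact: ex_derive.
  + by apply: cvg_at_right_filter; exact: cF.
  + by apply: cvg_at_left_filter; exact: cF.
- by move=> r _; rewrite derive1E; apply: derive_val.
Qed.

(** The jump of the velocity at [T1] is harmless: the integral splits there, and the two primitives
    agree at [T1]. *)
Lemma glued_primitive (f g F G : R -> R) (T1 T : R) :
  continuous f -> continuous g ->
  (forall r, is_derive (r : R) 1 F (f r)) ->
  (forall r, is_derive (r : R) 1 G (g r)) ->
  F T1 = G T1 -> 0 <= T1 -> T1 <= T ->
  let v t := if t <= T1 then f t else g t in
  let w t := if t <= T1 then F t else G t in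
  mu.-integrable `[0, T] (EFin \o v) /\
  (forall t, 0 <= t <= T -> w t = w 0 + \int[mu]_(r in `[0, t]) v r).
Proof.
move=> fc gc dF dG FG T10 T1T v w.
have vl (t : R) : t <= T1 -> {in `[0, t]%classic, f =1 v}.
  move=> tT1 r; rewrite inE /= in_itv /= => /andP[_ rt].
  by rewrite /v (le_trans rt tT1).
have vr (t : R) : {in `]T1, t]%classic, g =1 v}.
  move=> r; rewrite inE /= in_itv /= => /andP[rT1 _].
  by rewrite /v leNgt rT1.
have ifl := (Rintegral_derive T10 fc dF).1.
have igr : mu.-integrable `]T1, T] (EFin \o g).
  apply: integrableS (Rintegral_derive T1T gc dG).1 => //.
  by apply: subset_itvr; rewrite bnd_simp.
have iv : mu.-integrable `[0, T] (EFin \o v).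
  pose h1 := (EFin \o f) \_ `[0, T1]; pose h2 := (EFin \o g) \_ `]T1, T].
  pose h := (h1 \+ h2)%E.
  apply: (@eq_integrable _ _ _ mu _ _ h) => //.
    move=> r; rewrite inE /= in_itv /= /h /h1 /h2 /v => /andP[r0 rT] /=.
    rewrite !patchE !mem_setE !in_itv /= r0 rT andbT.
    by have [rT1|rT1] := leP r T1; rewrite ?adde0 ?add0e.
  by apply: integrableD => //; apply: (@integrableS _ _ _ mu setT) => //;
    rewrite -integrable_mkcond.
split => // t /andP[t0 tT]; rewrite /w T10.
have [tT1|tT1] := leP t T1.
  have -> : \int[mu]_(r in `[0, t]) v r = \int[mu]_(r in `[0, t]) f r.
    by apply: eq_Rintegral => r rI; rewrite (vl _ tT1).
  by rewrite (Rintegral_derive t0 fc dF).2; ring.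
have ivt : mu.-integrable `[0, t] (EFin \o v).
  by apply: integrableS iv => //; apply: subset_itvl; rewrite bnd_simp.
have -> : \int[mu]_(r in `[0, t]) v r =
    \int[mu]_(r in `[0, T1]) v r + \int[mu]_(r in `]T1, t]) v r.
  rewrite -(Rintegral_itvB ivt (x := T1)) ?bnd_simp //; first by ring.
  by rewrite ltW.
have -> : \int[mu]_(r in `[0, T1]) v r = \int[mu]_(r in `[0, T1]) f r.
  by apply: eq_Rintegral => r rI; rewrite (vl _ (lexx T1)).
have -> : \int[mu]_(r in `]T1, t]) v r = \int[mu]_(r in `]T1, t]) g r.
  by apply: eq_Rintegral => r rI; rewrite (vr t).
rewrite (Rintegral_derive T10 fc dF).2.
have [ig Eg] := Rintegral_derive (ltW tT1) gc dG.
rewrite Rintegral_itv_obnd_cbnd ?Eg; first by rewrite FG; ring.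
apply: integrableS ig => //.
by apply: subset_itvr; rewrite bnd_simp.
Qed.

End Glue.

Section ClosedOrbits.
Variable R : realType.
Implicit Types (gL gR aL aR b g c U : R).

Lemma is_derive_continuous (f df : R -> R) :
  (forall t, is_derive (t : R) 1 f (df t)) -> continuous f.
Proof.
by move=> dF r; apply/differentiable_continuous/derivable1_diffP; exact: ex_derive.
Qed.

Lemma closed_orbit_of_arcs gL gR aL aR b (T1 T y0 : R) (xL yL xR yR : R -> R) :
  (forall t, is_derive (t : R) 1 xL (2 * gL * xL t - yL t - b)) ->
  (forall t, is_derive (t : R) 1 yL ((1 + gL ^+ 2) * xL t - aL)) ->
  (forall t, is_derive (t : R) 1 xR (2 * gR * xR t - yR t + b)) ->
  (forall t, is_derive (t : R) 1 yR ((1 + gR ^+ 2) * xR t - aR)) ->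
  0 < T1 < T ->
  [/\ xL 0 = 0, yL 0 = y0, xL T1 = 0 & forall s, 0 < s < T1 -> xL s < 0] ->
  [/\ xR T1 = 0, yR T1 = yL T1 & forall s, T1 < s < T -> 0 < xR s] ->
  xR T = 0 -> yR T = y0 -> `|b| < y0 -> `|b| < `|yL T1| ->
  crossing_closed_orbit (left_field gL aL b) (right_field gR aR b) (0, y0) T
    (fun t => if t <= T1 then (xL t, yL t) else (xR t, yR t)).
Proof.
move=> dxL dyL dxR dyR /andP[T10 T1T] [xL0 yL0 xL1 xLneg] [xR1 yR1 xRpos] xRT yRT.
move=> by0 by1; set z := fun t => _.
have T0 := lt_trans T10 T1T.
have cxL := is_derive_continuous dxL; have cyL := is_derive_continuous dyL.
have cxR := is_derive_continuous dxR; have cyR := is_derive_continuous dyR.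
have clin (x y : R -> R) (k l m : R) : continuous x -> continuous y ->
    continuous (fun t => k * x t + l * y t + m).
  move=> cx cy t; apply: cvgD; last exact: cvg_cst.
  by apply: cvgD; apply: cvgM;
    [exact: cvg_cst|exact: cx|exact: cvg_cst|exact: cy].
have c1 : continuous (fun t => 2 * gL * xL t - yL t - b).
  rewrite (_ : (fun t => _) = (fun t => 2 * gL * xL t + -1 * yL t + - b)).
    exact: clin.
  by apply/funext => t; ring.
have c2 : continuous (fun t => (1 + gL ^+ 2) * xL t - aL).
  rewrite (_ : (fun t => _) = (fun t => (1 + gL ^+ 2) * xL t + 0 * yL t + - aL)).
    exact: clin.
  by apply/funext => t; ring.
have c3 : continuous (fun t => 2 * gR * xR t - yR t + b).
  rewrite (_ : (fun t => _) = (fun t => 2 * gR * xR t + -1 * yR t + b)).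
    exact: clin.
  by apply/funext => t; ring.
have c4 : continuous (fun t => (1 + gR ^+ 2) * xR t - aR).
  rewrite (_ : (fun t => _) = (fun t => (1 + gR ^+ 2) * xR t + 0 * yR t + - aR)).
    exact: clin.
  by apply/funext => t; ring.
have xLR : xL T1 = xR T1 by rewrite xL1 xR1.
have [i1 E1] := glued_primitive c1 c3 dxL dxR xLR (ltW T10) (ltW T1T).
have [i2 E2] := glued_primitive c2 c4 dyL dyR (esym yR1) (ltW T10) (ltW T1T).
pose v t := if t <= T1 then left_field gL aL b (xL t, yL t)
            else right_field gR aR b (xR t, yR t).
have v1 : (fun t => (v t).1) = (fun t => if t <= T1
    then 2 * gL * xL t - yL t - b else 2 * gR * xR t - yR t + b).
  by apply/funext => t; rewrite /v; case: ifP.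
have v2 : (fun t => (v t).2) = (fun t => if t <= T1
    then (1 + gL ^+ 2) * xL t - aL else (1 + gR ^+ 2) * xR t - aR).
  by apply/funext => t; rewrite /v; case: ifP.
have z1 t : (z t).1 = if t <= T1 then xL t else xR t by rewrite /z; case: ifP.
have z2 t : (z t).2 = if t <= T1 then yL t else yR t by rewrite /z; case: ifP.
have zT : z T = (0, y0) by rewrite /z leNgt T1T /= xRT yRT.
have z0 : z 0 = (0, y0) by rewrite /z (ltW T10) xL0 yL0.
split => //.
- exists v; split.
  + by move: i1; rewrite -v1.
  + by move: i2; rewrite -v2.
  + move=> t tT; split; first by rewrite !z1 E1 // v1.
    by rewrite !z2 E2 // v2.
  (* On the line the chosen velocity is an extreme convex combination: weight 1 on the left field at
     times 0 and [T1], weight 0 at [T]. *)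
  apply: aeW => t /andP[t0 tT]; rewrite /v /z; case: (leP t T1) => tT1.
    move: t0 tT1; rewrite le_eqVlt => /predU1P[<- _|t0].
      rewrite /filippov /= xL0 ltxx; exists 1; split => //.
      by rewrite subrr !mul0r !mul1r !addr0.
    rewrite le_eqVlt => /predU1P[->|tT1].
      rewrite /filippov /= xL1 ltxx; exists 1; split => //.
      by rewrite subrr !mul0r !mul1r !addr0.
    by rewrite /filippov /= xLneg // t0.
  move: tT; rewrite le_eqVlt => /predU1P[->|tT].
    rewrite /filippov /= xRT ltxx; exists 0; split => //.
    by rewrite subr0 !mul0r !mul1r !add0r.
  have xt := xRpos t; rewrite tT1 tT in xt.
  by rewrite /filippov /= ltNge (ltW (xt isT)) /= (xt isT).
- move=> t /andP[t0 tT] zt0; split => //.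
  have : `|b| < `|(z t).2|.
    move: zt0; rewrite z1 z2; case: (leP t T1) => tT1.
      move: t0; rewrite le_eqVlt => /predU1P[<- _|t0].
        by rewrite yL0 (lt_le_trans by0) // ler_norm.
      move: tT1; rewrite le_eqVlt => /predU1P[-> //|tT1] xt.
      by have := xLneg t; rewrite t0 tT1 xt ltxx => /(_ isT).
    move: tT; rewrite le_eqVlt => /predU1P[->|tT] xt.
      by rewrite yRT (lt_le_trans by0) // ler_norm.
    by have := xRpos t; rewrite tT1 tT xt ltxx => /(_ isT).
  rewrite -(ltr_pXn2r (n := 2)) ?nnegrE // !real_normK ?num_real //.
  by rewrite /= zt0 => h; lra.
Qed.

(** The ordinate recovered from [arc_z] when [b = 0]; starting at [y0] then means
    [U = y0 - g * c]. *)
Definition arc_y g c U (t : R) : R := arc_z g c U t + g * arc_x g c U t + g * c.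

Lemma is_derive_arc g c U (t : R) :
  is_derive t 1 (arc_x g c U) (2 * g * arc_x g c U t - arc_y g c U t) /\
  is_derive t 1 (arc_y g c U) ((1 + g ^+ 2) * (arc_x g c U t - c)).
Proof.
have dg : is_derive t 1 (fun s : R => g * s) g.
  by apply: is_derive_eq; rewrite /GRing.scale /= mulr1.
have de : is_derive t 1 (fun s => expR (g * s)) (expR (g * t) * g).
  exact: (@is_derive1_comp _ expR (fun s => g * s)).
have dx : is_derive t 1 (arc_x g c U) (2 * g * arc_x g c U t - arc_y g c U t).
  by apply: is_derive_eq; rewrite /arc_y /arc_x /arc_z /GRing.scale /=; ring.
split => //.
have dz : is_derive t 1 (arc_z g c U)
    (arc_x g c U t - c + g * arc_z g c U t).
  by apply: is_derive_eq; rewrite /arc_x /arc_z /GRing.scale /=; ring.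
by apply: is_derive_eq; rewrite /arc_y /GRing.scale /=; ring.
Qed.

(** The explicit arc enters [x < 0] at once and has [0 <= x] at time [3 * pi / 2]; its first return
    is the end, which [arc_return] places far down. *)
Lemma arc_exists g c (K : R) : exists M, forall y0, M < y0 -> exists t : R,
  [/\ 0 < t, forall s, 0 < s < t -> arc_x g c (y0 - g * c) s < 0,
      arc_x g c (y0 - g * c) t = 0 & K < - arc_y g c (y0 - g * c) t].
Proof.
have [M [M0 MP]] := arc_return g c (K + `|g * c|).
pose T : R := pi + pi / 2.
have T0 : 0 < T by rewrite /T; have := pi_gt0 R; lra.
have h0 : 0 <= `|c| / expR (g * T) by rewrite divr_ge0 ?expR_ge0.
have gc1 := ler_norm (g * c); have gc0 := normr_ge0 (g * c).
exists (M + `|g * c| + `|c| / expR (g * T)) => y0 My0.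
set U := y0 - g * c.
have y00 : 0 < y0 by lra.
have dx t := (is_derive_arc g c U t).1; have dy t := (is_derive_arc g c U t).2.
have cx := is_derive_continuous dx; have cy := is_derive_continuous dy.
have x0 : arc_x g c U 0 = 0.
  by rewrite /arc_x mulr0 expR0 cos0 sin0; ring.
have y0E : arc_y g c U 0 = y0.
  by rewrite /arc_y x0 /arc_z mulr0 expR0 cos0 sin0 /U; ring.
have xT : 0 <= arc_x g c U T.
  have cT : cos T = 0 by rewrite /T addrC cosDpi cos_pihalf oppr0.
  have sT : sin T = - 1 by rewrite /T addrC sinDpi sin_pihalf.
  have : `|c| / expR (g * T) < U by rewrite /U; lra.
  rewrite ltr_pdivrMr ?expR_gt0 // => h3.
  have : - c <= `|c| by rewrite -normrN ler_norm.
  by rewrite /arc_x cT sT; lra.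
have decr s t : s < t -> (forall r, s < r < t -> 2 * g * arc_x g c U r < arc_y g c U r) ->
    arc_x g c U t < arc_x g c U s.
  move=> st neg; rewrite -ltrN2.
  apply: (derive_lt (f := fun r => - arc_x g c U r)
    (df := fun r => - (2 * g * arc_x g c U r - arc_y g c U r)) st).
  by move=> r /neg; rewrite oppr_gt0 subr_lt0.
have near_pos t : arc_x g c U t = 0 -> 0 < arc_y g c U t -> exists2 d, 0 < d &
    forall r, `|r - t| < d -> 2 * g * arc_x g c U r < arc_y g c U r.
  move=> xt yt.
  have cl : continuous (fun r => arc_y g c U r - 2 * g * arc_x g c U r).
    by move=> r; apply: cvgB; [exact: cy|apply: cvgM; [exact: cvg_cst|exact: cx]].
  have lt0 : 0 < arc_y g c U t - 2 * g * arc_x g c U t by rewrite xt mulr0 subr0.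
  have /cvgrPdist_lt /(_ _ lt0)[d /= d0 dP] := cl t.
  exists d => // r rt; have := dP r; rewrite /= distrC => /(_ rt).
  by rewrite ltr_norml => /andP[_]; lra.
have [d d0 dP] : exists2 d, 0 < d &
    forall r, `|r - 0| < d -> 2 * g * arc_x g c U r < arc_y g c U r.
  by apply: near_pos => //; rewrite y0E.
have [t [/andP[t0 tT] xt xneg]] : exists t, [/\ 0 < t <= T, arc_x g c U t = 0 &
    forall s, 0 < s < t -> arc_x g c U s < 0].
  apply: (@first_zero _ (arc_x g c U) 0 d T) => //.
    exact: continuous_subspaceT.
  move=> s /andP[s0 _]; rewrite add0r => sd.
  rewrite -x0; apply: decr => // r /andP[r0 rs]; apply: dP.
  by rewrite subr0 gtr0_norm // (lt_trans rs).
exists t; split => //.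
(* With a positive ordinate at [t], [x] would decrease to 0 there, hence be positive just before. *)
have yt : arc_y g c U t <= 0.
  rewrite leNgt; apply/negP => yt; have [e e0 eP] := near_pos t xt yt.
  pose s := Num.max (t / 2) (t - e / 2).
  have s0 : 0 < s by rewrite lt_max divr_gt0.
  have st : s < t by rewrite gt_max; apply/andP; split; lra.
  have se : t - e / 2 <= s by rewrite le_max lexx orbT.
  have : arc_x g c U t < arc_x g c U s.
    apply: decr => // r /andP[r0 rs]; apply: eP.
    by rewrite ltr0_norm ?subr_lt0 //; lra.
  by rewrite xt ltNge ltW // xneg // s0.
have zt : arc_y g c U t = arc_z g c U t + g * c.
  by rewrite /arc_y xt mulr0 addr0.
have [] := MP U t _ t0 xneg xt; [by rewrite /U; lra|by lra|].
by move=> _ h _; lra.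
Qed.

End ClosedOrbits.

(** * Reversible systems and their centers *)

Section Sufficiency.
Variable R : realType.
Implicit Types gL gR aL aR b g c U : R.

(** The left arc followed by its mirror image in [x = 0], run backwards, closes up. *)
Lemma center_of_reversible_x0 g a :
  center_at_infinity (left_field g a 0) (right_field (- g) (- a) (0 : R)).
Proof.
pose c := a / (1 + g ^+ 2).
have g1 : 1 + g ^+ 2 != 0 by rewrite gt_eqF // ltr_pwDl ?sqr_ge0.
have aE : a = (1 + g ^+ 2) * c by rewrite /c; field.
have [M MP] := arc_exists g c 0.
exists (Num.max 1 M) => [|y0]; first by rewrite lt_max ltr01.
rewrite gt_max => /andP[y1 /MP[t [t0 xneg xt yt]]].
set U := y0 - g * c in xneg xt yt.
pose T := t + t; exists T; eexists.
have rev (f : R -> R) (s l : R) : is_derive (T - s) 1 f l ->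
    is_derive s 1 (fun r => f (T - r)) (- l).
  move=> fd; rewrite (_ : - l = l * -1); last by ring.
  apply: (@is_derive1_comp _ f (fun r => T - r)) => //.
  by apply: is_derive_eq; ring.
have x0 : arc_x g c U 0 = 0 by rewrite /arc_x mulr0 expR0 cos0 sin0; ring.
have y0E : arc_y g c U 0 = y0.
  by rewrite /arc_y x0 /arc_z mulr0 expR0 cos0 sin0 /U; ring.
have Tt : T - t = t by rewrite /T; ring.
apply: (@closed_orbit_of_arcs _ g (- g) a (- a) 0 t T y0 (arc_x g c U) (arc_y g c U)
  (fun s => - arc_x g c U (T - s)) (fun s => arc_y g c U (T - s))).
- by move=> s; rewrite subr0; exact: (is_derive_arc g c U s).1.
- move=> s; rewrite {1}aE -mulrBr; exact: (is_derive_arc g c U s).2.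
- by move=> s; have := rev _ _ _ (is_derive_arc g c U (T - s)).1 => ?;
    apply: is_derive_eq; ring.
- move=> s; have := rev _ _ _ (is_derive_arc g c U (T - s)).2.
  by move=> h; apply: is_derive_eq; rewrite aE; ring.
- by apply/andP; split => //; rewrite /T; lra.
- by split.
- rewrite Tt; split; rewrite ?xt ?oppr0 // => s /andP[ts sT].
  by rewrite oppr_gt0 xneg //; apply/andP; split; move: sT; rewrite /T; lra.
- by rewrite subrr x0 oppr0.
- by rewrite subrr.
- by rewrite normr0; lra.
- by rewrite normr0 normr_gt0; apply: contraTneq yt => ->; rewrite oppr0 ltxx.
Qed.

(** Without dilation the modulus is preserved, so the left arc goes from [y0] to [- y0]; the right
    arc, a left arc turned by the central symmetry, goes back. *)
Lemma center_of_reversible_y0 aL aR :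
  center_at_infinity (left_field 0 aL 0) (right_field 0 aR (0 : R)).
Proof.
have [M1 MP1] := arc_exists 0 aL 0; have [M2 MP2] := arc_exists 0 (- aR) 0.
exists (Num.max 1 (Num.max M1 M2)) => [|y0]; first by rewrite lt_max ltr01.
rewrite !gt_max => /and3P[y1 /MP1[t [t0 xneg xt yt]] /MP2[t' [t'0 xneg' xt' yt']]].
rewrite mul0r subr0 in xneg xt yt; rewrite mul0r subr0 in xneg' xt' yt'.
have y00 : 0 < y0 by lra.
have yE c (s : R) : arc_y 0 c y0 s = arc_z 0 c y0 s by rewrite /arc_y; ring.
have end_y c (s : R) : arc_x 0 c y0 s = 0 -> 0 < - arc_y 0 c y0 s ->
    arc_y 0 c y0 s = - y0.
  move=> xs; rewrite yE => zs.
  have := arc_norm xs; rewrite mul0r expR0 expr1n mul1r => /addIr/eqP.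
  rewrite eqf_sqr => /orP[/eqP zE|/eqP//].
  by move: zs; rewrite zE; lra.
have start_x c : arc_x 0 c y0 0 = 0.
  by rewrite /arc_x mulr0 expR0 cos0 sin0; ring.
have start_y c : arc_y 0 c y0 0 = y0.
  by rewrite /arc_y start_x /arc_z mulr0 expR0 cos0 sin0; ring.
pose T := t + t'; exists T; eexists.
have shift (f : R -> R) (s l : R) : is_derive (s - t) 1 f l ->
    is_derive s 1 (fun r => f (r - t)) l.
  move=> fd; rewrite -[l]mulr1.
  apply: (@is_derive1_comp _ f (fun r => r - t)) => //.
  by apply: is_derive_eq; ring.
have Tt : T - t = t' by rewrite /T; ring.
apply: (@closed_orbit_of_arcs _ 0 0 aL aR 0 t T y0 (arc_x 0 aL y0) (arc_y 0 aL y0)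
  (fun s => - arc_x 0 (- aR) y0 (s - t)) (fun s => - arc_y 0 (- aR) y0 (s - t))).
- by move=> s; rewrite subr0; exact: (is_derive_arc 0 aL y0 s).1.
- move=> s; have ? := (is_derive_arc 0 aL y0 s).2.
  by apply: is_derive_eq; ring.
- move=> s; have ? := shift _ _ _ (is_derive_arc 0 (- aR) y0 (s - t)).1.
  by apply: is_derive_eq; ring.
- move=> s; have ? := shift _ _ _ (is_derive_arc 0 (- aR) y0 (s - t)).2.
  by apply: is_derive_eq; ring.
- by apply/andP; split => //; rewrite /T; lra.
- by split.
- rewrite subrr start_x start_y oppr0 (end_y _ _ xt yt); split => // s /andP[ts sT].
  by rewrite oppr_gt0 xneg' //; apply/andP; split; move: sT; rewrite /T; lra.
- by rewrite Tt xt' oppr0.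
- by rewrite Tt (end_y _ _ xt' yt') opprK.
- by rewrite normr0.
- by rewrite normr0 (end_y _ _ xt yt) normrN gtr0_norm.
Qed.

Lemma reversible_wrt_y0P gL gR aL aR b :
  reversible_wrt_y0 (filippov (left_field gL aL b) (right_field gR aR b)) <->
  b = 0 /\ gL = 0 /\ gR = 0.
Proof.
set F := filippov _ _; split=> [rev|[b0 [gL0 gR0]]].
  (* At [y = 0] reversibility forces the first component to equal its opposite; two abscissas on
     each side then determine the parameters. *)
  have left_rev (x : R) : x < 0 -> 2 * gL * x = b.
    move=> x0; have := rev x 0 (2 * gL * x - 0 - b) ((1 + gL ^+ 2) * x - aL).
    rewrite /F /filippov /= x0 /left_field /= => -[/(_ erefl)[h] _].
    by move: h; lra.
  have right_rev (x : R) : 0 < x -> 2 * gR * x = - b.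
    move=> x0; have := rev x 0 (2 * gR * x - 0 + b) ((1 + gR ^+ 2) * x - aR).
    rewrite /F /filippov /= ltNge (ltW x0) /= x0 /right_field /= => -[/(_ erefl)[h] _].
    by move: h; lra.
  have := left_rev (-1); have := left_rev (-2).
  have := right_rev 1; have := right_rev 2.
  rewrite !oppr_lt0 ltr01 (@ltr0n R 2) => /(_ isT) ? /(_ isT) ? /(_ isT) ? /(_ isT) ?.
  by split; [lra|split; lra].
have half x y u w : F (x, y) (u, w) -> F (x, - y) (- u, w).
  rewrite /F /filippov /=; case: ifP => _.
    by rewrite /left_field /= => -[-> ->]; congr pair; rewrite gL0 b0; ring.
  case: ifP => _.
    by rewrite /right_field /= => -[-> ->]; congr pair; rewrite gR0 b0; ring.
  move=> [l [l0 l1 [-> ->]]]; exists l; split => //.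
  by congr pair; rewrite gL0 gR0 b0; ring.
move=> x y u w; split => [|/half]; first exact: half.
by rewrite !opprK.
Qed.

Lemma reversible_wrt_x0P gL gR aL aR b :
  reversible_wrt_x0 (filippov (left_field gL aL b) (right_field gR aR b)) <->
  b = 0 /\ gL = - gR /\ aL = - aR.
Proof.
set F := filippov _ _; split=> [rev|[b0 [gE aE]]].
  have E (x : R) : x < 0 -> 2 * gL * x - b = - (2 * gR * x) + b /\
      (1 + gL ^+ 2) * x - aL = (1 + gR ^+ 2) * x + aR.
    move=> x0; have := rev x 0 (2 * gL * x - 0 - b) ((1 + gL ^+ 2) * x - aL).
    rewrite /F /filippov /= x0 oppr_lt0 oppr_gt0 ltNge (ltW x0) /= x0.
    rewrite /left_field /right_field /= => -[/(_ erefl)[h1 h2] _].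
    by move: h1 h2; split; lra.
  have [] := E (-1) _; first by rewrite oppr_lt0.
  have [] := E (-2) _; first by rewrite oppr_lt0.
  move=> h1 _ h2 h3; have b0 : b = 0 by lra.
  have gE : gL = - gR by lra.
  by split => //; split => //; move: h3; rewrite gE sqrrN; lra.
have half x y u w : F (x, y) (u, w) -> F (- x, y) (u, - w).
  rewrite /F /filippov /= oppr_lt0 oppr_gt0; case: ltgtP => [x0|x0|->].
  - by rewrite /left_field /right_field /= => -[-> ->]; rewrite b0 gE aE;
      congr pair; ring.
  - by rewrite /left_field /right_field /= => -[-> ->]; rewrite b0 gE aE;
      congr pair; ring.
  (* On the line the reflection exchanges the two fields, hence their weights. *)
  - move=> [l [l0 l1 [-> ->]]]; exists (1 - l); split; [lra|lra|].
    by rewrite b0 gE aE; congr pair; ring.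
move=> x y u w; split => [|/half]; first exact: half.
by rewrite !opprK.
Qed.

End Sufficiency.

Theorem theorem3 (R : realType) (gL gR aL aR b : R) :
  let XL := left_field gL aL b in
  let XR := right_field gR aR b in
  let F := filippov XL XR in
  [/\ center_at_infinity XL XR <->
        reversible_wrt_y0 F \/ reversible_wrt_x0 F,
      (center_at_infinity XL XR /\ reversible_wrt_y0 F) <->
        (b = 0 /\ gL = 0 /\ gR = 0)
    & (center_at_infinity XL XR /\ reversible_wrt_x0 F
         /\ ~ reversible_wrt_y0 F) <->
        (b = 0 /\ (gL = - gR /\ gL <> 0) /\
         ((aL = 0 /\ aR = 0) \/ (aL = - aR /\ aL <> 0)))].
Proof.
move=> XL XR F.
have ryP : reversible_wrt_y0 F <-> b = 0 /\ gL = 0 /\ gR = 0.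
  exact: reversible_wrt_y0P.
have rxP : reversible_wrt_x0 F <-> b = 0 /\ gL = - gR /\ aL = - aR.
  exact: reversible_wrt_x0P.
have center_y : b = 0 /\ gL = 0 /\ gR = 0 -> center_at_infinity XL XR.
  by rewrite /XL /XR => -[-> [-> ->]]; exact: center_of_reversible_y0.
have center_x : b = 0 /\ gL = - gR /\ aL = - aR -> center_at_infinity XL XR.
  rewrite /XL /XR => -[-> [gE aE]].
  by rewrite -[gR]opprK -[aR]opprK -gE -aE; exact: center_of_reversible_x0.
split.
- split=> [/center_at_infinity_necessary[|]|[/ryP|/rxP]] //.
  + by move=> /ryP; left.
  + by move=> /rxP; right.
- by split=> [[_ /ryP]//|h]; split; [exact: center_y|exact/ryP].
(* Given [b = 0] and [gL = - gR], failure of the reversibility in [y = 0] amounts to [gL <> 0]; the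
   alternative on [aL] only splits [aL = - aR]. *)
split=> [[_ [/rxP[b0 [gE aE]] nry]]|[b0 [[gE gn0] aE]]].
  split => //; split; first split => //.
    by move=> g0; apply: nry; apply/ryP; do 2 split => //; lra.
  have [a0|/eqP an0] := eqVneq aL 0; last by right.
  by left; split => //; lra.
have aE' : aL = - aR by case: aE => [[-> ->]|[]//]; rewrite oppr0.
split; first exact: center_x.
by split; [exact/rxP|move=> /ryP[_ [/gn0]]].
Qed.
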